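(* Assume that the tensor $C$ satisfies the stated assumptions (symmetric, isotropic, homogeneous and positive), that $f\in C([0,T];L^2(\Omega;\mathbb{R}^d))$, $g\in C([0,T];H^1(\Omega;\mathbb{R}^d))$, $q\in C([0,T];L^2(\Gamma_1;\mathbb{R}^d))$, $\phi^0\in L^2(\Omega;\mathbb{R}^{d\times d}_{\rm sym})$, and that $f,g,q$ are independent of time, i.e. $\partial f/\partial t=0$, $\partial g/\partial t=0$, $\partial q/\partial t=0$. Suppose that $\{g_h^k\}_{k=0}^{N_T}\subset X_h$ and $\phi_h^0\in\Psi_h$ are given, with $g_h^k=g_h$ independent of $k$. Let $\{(u_h^k,\phi_h^k)\in V_h(g_h)\times\Psi_h;\ k=0,\dots,N_T\}$ be the solution (with the given $\phi_h^0$) of $$(\sigma[u_h^k,\phi_h^k],e[v_h])_\Psi=\ell(v_h)\quad\forall v_h\in V_h,\quad k=0,\dots,N_T,$$ $$\eta\overline{D}_\tau\phi_h^k+\alpha\phi_h^k-\sigma[u_h^k,\phi_h^k]=0\ \text{ in }\Psi_h,\quad k=1,\dots,N_T.$$ Set $E_h^k=E(u_h^k,\phi_h^k)$. Then for any $k=1,\dots,N_T$: (i) (Gradient flow structure) $$(\eta\overline{D}_\tau\phi_h^k,\psi_h)_\Psi=-(\partial E_{h\ast})(\phi_h^k)[\psi_h]\quad\forall\psi_h\in\Psi_h.$$ (ii) (Energy decay estimate) $$\overline{D}_\tau E_h^k+\frac{\alpha\tau}{2}\bigl\|\overline{D}_\tau\phi_h^k\bigr\|_\Psi^2+\frac{\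tau}{2}\bigl\|\overline{D}_\tau(e[u_h^k]-\phi_h^k)\bigr\|_C^2=-\eta\bigl\|\overline{D}_\tau\phi_h^k\bigr\|_\Psi^2\le0.$$
   Context: Let $d\in\{2,3\}$, $T>0$, and let $\Omega\subset\mathbb{R}^d$ be a bounded Lipschitz domain with boundary $\Gamma=\partial\Omega$. $\Gamma_0$ is an open subset of $\Gamma$ whose $(d-1)$-dimensional measure is positive and equal to that of $\overline{\Gamma}_0$, and $\Gamma_1=\Gamma\setminus\overline{\Gamma}_0$ (the case $\Gamma_0=\Gamma$, $\Gamma_1=\emptyset$ is allowed). $\eta>0$ and $\alpha\ge0$ are constants. $\mathbb{R}^{d\times d}_{\rm sym}$ is the space of real symmetric $d\times d$ matrices; $A:B=\sum_{i,j}A_{ij}B_{ij}$. Tensor $C=(c_{ijkl})$: $c_{ijkl}=\lambda\delta_{ij}\delta_{kl}+\mu(\delta_{ik}\delta_{jl}+\delta_{il}\delta_{jk})$ with constants $\lambda,\mu\in\mathbb{R}$, and there is $c_\ast>0$ with $\sum_{i,j,k,l}c_{ijkl}\xi_{ij}\xi_{kl}\ge c_\ast|\xi|^2$ for all $\xi\in\mathbb{R}^{d\times d}_{\rm sym}$, where $|\xi|^2=\sum_{i,j}\xi_{ij}^2$. It acts by $(C\xi)_{ij}=\sum_{k,l}c_{ijkl}\xi_{kl}$. Notation: $e[u]=\frac12[\nabla u+(\nabla u)^T]$, $\sigma[u,\phi]=C(e[u]-\phi)$. $X=H^1(\Omega;\mathbb{R}^d)$; $V(g_0)=\{v\in X: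 v|_{\Gamma_0}=g_0|_{\Gamma_0}\}$ (traces) for $g_0\in X$; $\Psi=L^2(\Omega;\mathbb{R}^{d\times d}_{\rm sym})$. $(\phi,\psi)_\Psi=\int_\Omega\phi:\psi\,dx$, $(\phi,\psi)_C=(C\phi,\psi)_\Psi$, with norms $\|\cdot\|_\Psi$, $\|\cdot\|_C$. $(\cdot,\cdot)$ is the inner product of $L^2(\Omega;\mathbb{R}^d)$. $\ell(v)=(f,v)+\int_{\Gamma_1}q\cdot v\,ds$ (independent of time since $f,q$ are). Time discretization: $\tau>0$ is a time increment, $N_T=\lfloor T/\tau\rfloor$, $t^k=k\tau$, and $\overline{D}_\tau\rho^k=(\rho^k-\rho^{k-1})/\tau$ for any sequence $\rho^k$. Finite element spaces: $\mathcal{T}_h=\{K\}$ is a triangulation of $\Omega$ into simplices with representative size $h$, and it is assumed that $\Omega=\mathrm{int}(\bigcup_{K\in\mathcal{T}_h}K)$. $X_h=\{v_h\in C(\overline\Omega;\mathbb{R}^d): v_h|_K \text{ is a polynomial map of degree at most }1\ \forall K\in\mathcal{T}_h\}$; $\Psi_h=\{\psi_h\in L^2(\Omega;\mathbb{R}^{d\times d}_{\rm sym}):\psi_h|_K\text{ is constant }\forall K\in\mathcal{T}_h\}$; $V_h(g_{0h})=X_h\cap V(g_{0h})$ for $g_{0h}\in X_h$, and $V_h=V_h(0)$. Energy: $E(u,\phi)=\frac12\|e[u]-\phi\|_C^2+\frac{\alpha}{2}\|\phi\|_\Psi^2-\ell(u)$, evaluated here on $V_h(g_h)\times\Psi_h$.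 Discrete reduced energy: $E_{h\ast}(\psi_h)=\min_{v_h\in V_h(g_h)}E(v_h,\psi_h)$ for $\psi_h\in\Psi_h$, with Gâteaux derivative $(\partial E_{h\ast})(\phi_h)[\psi_h]=\frac{d}{d\varepsilon}E_{h\ast}(\phi_h+\varepsilon\psi_h)|_{\varepsilon=0}$ for $\phi_h,\psi_h\in\Psi_h$. *)

(* Defs.v *)
From HB Require Import structures.
From mathcomp Require Import all_boot all_order all_algebra.
From mathcomp Require Import all_classical all_reals all_analysis.

Set Implicit Arguments.
Unset Strict Implicit.
Unset Printing Implicit Defensive.

Import Order.TTheory GRing.Theory Num.Theory.
Import numFieldNormedType.Exports.

Local Open Scope classical_set_scope.
Local Open Scope ring_scope.

(* Outer measure obtained from the countable covers by the sets [B i], the set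
   [B i] having the cost [c i]. The value [None] makes finite covers countable
   ones, so that no [B i] need be empty or of cost 0. *)
Section cover_outer.
Local Open Scope ereal_scope.
Context (R : realType) (T I : Type) (B : I -> set T) (c : I -> \bar R).

Definition cover_set (i : option I) : set T := oapp B set0 i.
Definition cover_cost (i : option I) : \bar R := oapp c 0 i.

Definition cover_outer (A : set T) : \bar R :=
  ereal_inf [set \sum_(k <oo) cover_cost (F k)
            | F in [set F : nat -> option I | A `<=` \bigcup_k cover_set (F k)]].

Hypothesis c_ge0 : forall i, 0 <= c i.

Lemma cover_cost_ge0 i : 0 <= cover_cost i.
Proof. by case: i => /=. Qed.

Lemma le_cover_outer : {homo cover_outer : A A' / A `<=` A' >-> A <= A'}.
Proof.
move=> A A' AA'; apply/ereal_inf_le_tmp => x [F AF <-].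
by exists F => //; exact: subset_trans AF.
Qed.

Lemma cover_outer_ge0 A : 0 <= cover_outer A.
Proof.
apply: le_ereal_inf_tmp => x [F AF <-].
by apply: nneseries_ge0 => *; exact: cover_cost_ge0.
Qed.

Lemma cover_outer0 : cover_outer set0 = 0.
Proof.
apply/eqP; rewrite eq_le cover_outer_ge0 andbT.
apply: ereal_inf_lbound; exists (fun=> None) => //=.
exact: eseries0.
Qed.

Lemma cover_outer_sigma_subadditive : sigma_subadditive cover_outer.
Proof.
move=> A; have [[i ioo]|] := pselect (exists i, cover_outer (A i) = +oo).
  by rewrite (eseries_pinfty _ _ ioo) ?leey// => n _;
    rewrite -ltNye (lt_le_trans _ (cover_outer_ge0 _)).
rewrite -forallNE => Aoo.
apply/lee_addgt0Pr => _/posnumP[e].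
rewrite (le_trans _ (epsilon_trick _ _ _))//; last first.
  by move=> n; exact: cover_outer_ge0.
pose P n (F : nat -> option I) := A n `<=` \bigcup_k cover_set (F k) /\
  \sum_(k <oo) cover_cost (F k) <=
    cover_outer (A n) + (e%:num / (2 ^ n.+1)%:R)%:E.
have [G PG] : {G : nat -> nat -> option I & forall n, P n (G n)}.
  apply: (@choice _ _ P) => n; rewrite /P /cover_outer.
  set S := (X in ereal_inf X); move infS : (ereal_inf S) => iS.
  case: iS infS => [r Sr|Soo|Soo].
  - have en1 : (0 < e%:num / (2 ^ n.+1)%:R)%R by [].
    have /(lb_ereal_inf_adherent en1) : ereal_inf S \is a fin_num by rewrite Sr.
    move=> [x [F AnF Fx] xS].
    by exists F; split => //; rewrite Fx -Sr; exact/ltW.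
  - by have := Aoo n; rewrite /cover_outer Soo.
  - suff : lbound S 0 by move/le_ereal_inf_tmp; rewrite Soo.
    by move=> /= _ [F AnF <-]; apply: nneseries_ge0 => *; exact: cover_cost_ge0.
have G_ge0 x : 0 <= (cover_cost \o uncurry G) x by exact: cover_cost_ge0.
apply: (@le_trans _ _ (\esum_(i in setT) (cover_cost \o uncurry G) i)).
  rewrite /cover_outer; apply: ereal_inf_lbound => /=.
  have /card_esym/ppcard_eqP[f] := card_nat2.
  exists (uncurry G \o f).
    move=> t [i _] /(PG i).1 -[j _ Bijt]; exists (f^-1%FUN (i, j)) => //=.
    by rewrite invK ?inE.
  rewrite -(esum_pred_image (cover_cost \o uncurry G) _ xpredT) ?[fun=> _]set_true//.
  by rewrite image_eq.
rewrite (_ : esum _ _ = \sum_(i <oo) \sum_(j <oo) cover_cost (G i j)); last first.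
  pose J : nat -> set (nat * nat) := fun i => [set (i, j) | j in setT].
  rewrite (_ : setT = \bigcup_k J k); last first.
    by rewrite predeqE => -[a b]; split => // _; exists a => //; exists b.
  rewrite esum_bigcupT /=; last 2 first.
    - apply/trivIsetP => i j _ _ ij.
      rewrite predeqE => -[n m] /=; split => //= -[] [_] _ [<-{n} _].
      by move=> [m' _] [] /esym/eqP; rewrite (negbTE ij).
    - by move=> x; exact: G_ge0.
  rewrite -(image_id [set: nat]) -fun_true esum_pred_image//; last first.
    by move=> n _; apply: esum_ge0 => ? _; exact: G_ge0.
  apply: eq_eseriesr => /= j _.
  rewrite -(esum_pred_image (cover_cost \o uncurry G) (pair j) predT)//=.
  - by congr esum; rewrite predeqE => -[a b]; split; move=> [i _ <-]; exists i.
  - by move=> ? ? ; exact: cover_cost_ge0.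
  - by move=> ? ? _ _; exact: (@can_inj _ _ _ snd).
apply: lee_lim.
- apply: is_cvg_nneseries => n *.
  by apply: nneseries_ge0 => m *; exact: (G_ge0 (n, m)).
- by apply: is_cvg_nneseries => n *; apply: adde_ge0 => //; exact: cover_outer_ge0.
- by near=> n; apply: lee_sum => i _; exact: (PG i).2.
Unshelve. all: by end_near. Qed.

End cover_outer.

(* The canonical norm of ['rV[R]_d] is the maximum norm; lengths and diameters
   are taken for the Euclidean norm. *)
Section euclidean.
Context (R : realType).

Definition dotmx (m n : nat) (A B : 'M[R]_(m, n)) : R :=
  \sum_(i < m) \sum_(j < n) A i j * B i j.

Definition enorm (d : nat) (x : 'rV[R]_d) : R := Num.sqrt (dotmx x x).

Definition diam (d : nat) (U : set 'rV[R]_d) : R :=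
  sup [set enorm (p.1 - p.2) | p in U `*` U].

(* Volume of the unit ball of dimension [s], from the recurrence
   omega_s = (2 pi / s) omega_(s-2). *)
Fixpoint ball_volume (s : nat) : R :=
  match s with
  | 0 => 1
  | 1 => 2
  | s'.+2 => 2 * pi / s%:R * ball_volume s'
  end.

End euclidean.

Section lebesgue_outer.
Context (R : realType) (d : nat).

Definition box (p : 'rV[R]_d * 'rV[R]_d) : set 'rV[R]_d :=
  [set x | forall j, p.1 ord0 j <= x ord0 j <= p.2 ord0 j].

Definition box_volume (p : 'rV[R]_d * 'rV[R]_d) : \bar R :=
  (\prod_(j < d) Num.max 0 (p.2 ord0 j - p.1 ord0 j))%:E.

Definition lebesgue_outer : set 'rV[R]_d -> \bar R :=
  cover_outer box box_volume.

Lemma box_volume_ge0 p : (0 <= box_volume p)%E.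
Proof. by rewrite lee_fin prodr_ge0// => j _; rewrite le_max lexx. Qed.

HB.instance Definition _ := isOuterMeasure.Build R 'rV[R]_d lebesgue_outer
  (@cover_outer0 _ _ _ box _ box_volume_ge0) (@cover_outer_ge0 _ _ _ box _ box_volume_ge0)
  (@le_cover_outer _ _ _ box box_volume)
  (@cover_outer_sigma_subadditive _ _ _ box _ box_volume_ge0).

(* Lebesgue measure of R^d, on the Lebesgue-measurable sets *)
Definition vol :
    {measure set (caratheodory_type lebesgue_outer) -> \bar R} :=
  OuterMeasure.sort (lebesgue_outer : {outer_measure set 'rV[R]_d -> \bar R}).

End lebesgue_outer.

Section hausdorff_outer.
Context (R : realType) (d s : nat).

Definition small_set (delta : {posnum R}) :=
  {U : set 'rV[R]_d | forall x y, U x -> U y -> enorm (x - y) <= delta%:num}.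

Definition small_cost (delta : {posnum R}) (U : small_set delta) : \bar R :=
  (ball_volume R s * (diam (sval U) / 2) ^+ s)%:E.

Definition hausdorff_pre (delta : {posnum R}) : set 'rV[R]_d -> \bar R :=
  cover_outer (fun U : small_set delta => sval U) (@small_cost delta).

Definition hausdorff_outer (A : set 'rV[R]_d) : \bar R :=
  ereal_sup [set hausdorff_pre delta A | delta in [set: {posnum R}]].

Lemma small_cost_ge0 delta (U : small_set delta) : (0 <= small_cost U)%E.
Proof.
have ball_ge0 : forall n, 0 <= ball_volume R n /\ 0 <= ball_volume R n.+1.
  elim=> [|n [IH1 IH2]]; first by split => /=.
  by split=> //; rewrite /= !mulr_ge0 ?invr_ge0 ?pi_ge0.
rewrite lee_fin mulr_ge0 ?(ball_ge0 _).1// exprn_ge0// divr_ge0//.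
rewrite /diam; set D := [set _ | _ in _].
have [supD|/sup_out->//] := pselect (has_sup D).
have [[r Dr] ubD] := supD.
apply: le_trans (ub_le_sup ubD Dr).
by case: Dr => p _ <-; exact: sqrtr_ge0.
Qed.

Lemma hausdorff_outer_ge0 A : (0 <= hausdorff_outer A)%E.
Proof.
apply: (@le_trans _ _ (hausdorff_pre 1%:pos A)).
  by apply: cover_outer_ge0; exact: small_cost_ge0.
by apply: ereal_sup_ubound; exists 1%:pos.
Qed.

Lemma hausdorff_outer0 : hausdorff_outer set0 = 0%E.
Proof.
apply/eqP; rewrite eq_le hausdorff_outer_ge0 andbT.
apply: ge_ereal_sup => _ [delta _ <-].
by rewrite /hausdorff_pre cover_outer0//; exact: small_cost_ge0.
Qed.

Lemma le_hausdorff_outer :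
  {homo hausdorff_outer : A A' / A `<=` A' >-> (A <= A')%E}.
Proof.
move=> A A' AA'; apply: ge_ereal_sup => _ [delta _ <-].
apply: (@le_trans _ _ (hausdorff_pre delta A')); first exact: le_cover_outer.
by apply: ereal_sup_ubound; exists delta.
Qed.

Lemma hausdorff_outer_sigma_subadditive : sigma_subadditive hausdorff_outer.
Proof.
move=> F; apply: ge_ereal_sup => _ [delta _ <-].
apply: (@le_trans _ _ (\sum_(i <oo) hausdorff_pre delta (F i))%E).
  by apply: cover_outer_sigma_subadditive; exact: small_cost_ge0.
apply: lee_nneseries => [i _ _|i _].
  by apply: cover_outer_ge0; exact: small_cost_ge0.
by apply: ereal_sup_ubound; exists delta.
Qed.

HB.instance Definition _ := isOuterMeasure.Build R 'rV[R]_d hausdorff_outer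
  hausdorff_outer0 hausdorff_outer_ge0 le_hausdorff_outer
  hausdorff_outer_sigma_subadditive.

(* The factor [ball_volume] makes this the usual surface measure ([s = d - 1])
   on Lipschitz hypersurfaces. *)
Definition hausdorff :
    {measure set (caratheodory_type hausdorff_outer) -> \bar R} :=
  OuterMeasure.sort
    (hausdorff_outer : {outer_measure set 'rV[R]_d -> \bar R}).

End hausdorff_outer.
Arguments hausdorff {R} d s.
Arguments vol {R} d.

Definition surf {R : realType} (d : nat) := hausdorff (R := R) d d.-1.

Section square_integrable.
Context (dT : measure_display) (T : measurableType dT) (R : realType).
Context (mu : {measure set T -> \bar R}) (D : set T) (m n : nat).
Implicit Types f g : T -> 'M[R]_(m, n).

(* Elements of L^2 are represented by functions on the whole space; only their
   values almost everywhere in [D] matter. *)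
Definition L2 f : Prop := forall i j,
  measurable_fun D (fun x => f x i j) /\
  mu.-integrable D (fun x => (f x i j ^+ 2)%:E).

Definition ip f g : R := \int[mu]_(x in D) dotmx (f x) (g x).

Definition norm2 f : R := Num.sqrt (ip f f).

Definition cont_L2 (tmax : R) (f : R -> T -> 'M[R]_(m, n)) : Prop :=
  forall t, t \in `[0, tmax] -> L2 (f t) /\
    norm2 (fun x => f s x - f t x) @[s --> within `[0, tmax] (nbhs t)] --> 0.

Definition time_independent (tmax : R) (f : R -> T -> 'M[R]_(m, n)) : Prop :=
  forall s t, s \in `[0, tmax] -> t \in `[0, tmax] ->
    f s = f t %[ae mu in D].

End square_integrable.

Definition boundary (T : topologicalType) (A : set T) : set T :=
  closure A `\` interior A.

Section domain.
Context (R : realType) (d : nat).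
Implicit Types Omega : set 'rV[R]_d.

(* Near each boundary point, in orthonormal coordinates [y *m Q], the domain is
   the part of space lying above the graph of a Lipschitz function of all the
   coordinates but the [j]-th. *)
Definition lipschitz_boundary Omega : Prop :=
  forall x, boundary Omega x ->
    exists (Q : 'M[R]_d) (j : 'I_d) (zeta : 'rV[R]_d.-1 -> R),
      [/\ Q *m Q^T = 1%:M, lipschitz zeta &
          \forall y \near x,
            Omega y <-> zeta (col' j (y *m Q)) < (y *m Q) ord0 j].

Definition lipschitz_domain Omega : Prop :=
  [/\ Omega !=set0, open Omega, connected Omega, bounded_set Omega
    & lipschitz_boundary Omega].

End domain.

Section sobolev.
Context (R : realType) (d : nat) (Omega : set 'rV[R]_d).

Definition partial (j : 'I_d) (f : 'rV[R]_d -> R) : 'rV[R]_d -> R :=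
  'D_(delta_mx ord0 j) f.

Fixpoint class_C (k : nat) (f : 'rV[R]_d -> R) : Prop :=
  continuous f /\
  match k with
  | 0 => True
  | k'.+1 => forall j, (forall x, derivable f x (delta_mx ord0 j)) /\
                       class_C k' (partial j f)
  end.

Definition test_function (f : 'rV[R]_d -> R) : Prop :=
  let supp := closure [set x | f x != 0] in
  [/\ forall k, class_C k f, compact supp & supp `<=` Omega].

Definition is_weak_grad (u : 'rV[R]_d -> 'rV[R]_d) (G : 'rV[R]_d -> 'M[R]_d) :=
  L2 (vol d) Omega G /\
  forall f, test_function f -> forall i j,
    \int[vol d]_(x in Omega) (u x ord0 i * partial j f x) =
    - \int[vol d]_(x in Omega) (G x i j * f x).

Definition H1 (u : 'rV[R]_d -> 'rV[R]_d) : Prop :=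
  L2 (vol d) Omega u /\ exists G, is_weak_grad u G.

(* The weak gradient is unique almost everywhere in [Omega]; [grad u] is a chosen
   representative, with [grad u x i j] the j-th partial derivative of [u_i]. *)
Definition grad (u : 'rV[R]_d -> 'rV[R]_d) : 'rV[R]_d -> 'M[R]_d :=
  xget (fun=> 0) [set G | is_weak_grad u G].

Definition normH1 (u : 'rV[R]_d -> 'rV[R]_d) : R :=
  Num.sqrt (ip (vol d) Omega u u + ip (vol d) Omega (grad u) (grad u)).

Definition cont_H1 (tmax : R) (g : R -> 'rV[R]_d -> 'rV[R]_d) : Prop :=
  forall t, t \in `[0, tmax] -> H1 (g t) /\
    normH1 (fun x => g s x - g t x) @[s --> within `[0, tmax] (nbhs t)] --> 0.


(* The trace operator: the bounded linear operator from H^1(Omega) to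
   L^2(boundary Omega) that restricts to the boundary the functions of H^1 that
   are continuous up to the boundary. On a bounded Lipschitz domain it exists
   and is unique (up to equality almost everywhere). *)
Definition is_trace (gam : ('rV[R]_d -> 'rV[R]_d) -> 'rV[R]_d -> 'rV[R]_d) :=
  [/\ forall a u v, H1 u -> H1 v ->
        gam (a *: u + v) = a *: gam u + gam v %[ae surf d in boundary Omega],
      exists c, forall u, H1 u -> L2 (surf d) (boundary Omega) (gam u) /\
        norm2 (surf d) (boundary Omega) (gam u) <= c * normH1 u
    & forall u, H1 u -> {within closure Omega, continuous u} ->
        gam u = u %[ae surf d in boundary Omega]].

Definition symgrad (u : 'rV[R]_d -> 'rV[R]_d) : 'rV[R]_d -> 'M[R]_d :=
  fun x => 2^-1 *: (grad u x + (grad u x)^T).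

Definition L2sym (psi : 'rV[R]_d -> 'M[R]_d) : Prop :=
  L2 (vol d) Omega psi /\ \forall x \ae vol d, Omega x -> (psi x)^T = psi x.

Definition Vspace (gam : ('rV[R]_d -> 'rV[R]_d) -> 'rV[R]_d -> 'rV[R]_d)
    (Gamma0 : set 'rV[R]_d) (g0 v : 'rV[R]_d -> 'rV[R]_d) : Prop :=
  H1 v /\ gam v = gam g0 %[ae surf d in Gamma0].

End sobolev.

Section triangulation.
Context (R : realType) (d : nat).

(* Row [i] of [P] is the [i]-th vertex of a simplex; [face P J] is the convex
   hull of the vertices with index in [J] (empty if [J] is). *)
Definition face (P : 'M[R]_(d.+1, d)) (J : {set 'I_d.+1}) : set 'rV[R]_d :=
  [set x | exists w : 'rV[R]_d.+1,
     [/\ forall i, 0 <= w ord0 i, forall i, i \notin J -> w ord0 i = 0,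
         \sum_i w ord0 i = 1 & x = w *m P]].

Definition simplex (P : 'M[R]_(d.+1, d)) : set 'rV[R]_d := face P [set: 'I_d.+1].

Definition affinely_independent (P : 'M[R]_(d.+1, d)) : Prop :=
  row_free (row_mx P (const_mx 1 : 'cV_d.+1)).

(* The second clause says that two simplices meet in a common face, possibly
   empty. *)
Definition triangulation (Th : seq 'M[R]_(d.+1, d)) (Omega : set 'rV[R]_d) :=
  [/\ forall P, P \in Th -> affinely_independent P,
      forall P Q, P \in Th -> Q \in Th -> exists J K,
        simplex P `&` simplex Q = face P J /\
        simplex P `&` simplex Q = face Q K
    & Omega = interior (\bigcup_(P in [set` Th]) simplex P)].

Definition Xh (Th : seq 'M[R]_(d.+1, d)) (Omega : set 'rV[R]_d)
    (v : 'rV[R]_d -> 'rV[R]_d) : Prop :=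
  {within closure Omega, continuous v} /\
  forall P, P \in Th -> exists (A : 'M[R]_d) (b : 'rV[R]_d),
    forall x, simplex P x -> v x = x *m A + b.

(* Almost everywhere, because neighbouring closed simplices share a face. *)
Definition Psih (Th : seq 'M[R]_(d.+1, d)) (Omega : set 'rV[R]_d)
    (psi : 'rV[R]_d -> 'M[R]_d) : Prop :=
  L2sym Omega psi /\
  forall P, P \in Th -> exists M : 'M[R]_d,
    \forall x \ae vol d, simplex P x -> psi x = M.

Definition Vh (Th : seq 'M[R]_(d.+1, d)) (Omega : set 'rV[R]_d)
    (gam : ('rV[R]_d -> 'rV[R]_d) -> 'rV[R]_d -> 'rV[R]_d)
    (Gamma0 : set 'rV[R]_d) (g0 v : 'rV[R]_d -> 'rV[R]_d) : Prop :=
  Xh Th Omega v /\ Vspace Omega gam Gamma0 g0 v.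

End triangulation.

Section tensor.
Context (R : realType) (d : nat) (lam mu : R).

Definition tensorC (i j k l : 'I_d) : R :=
  lam * ((i == j)%:R * (k == l)%:R) +
  mu * ((i == k)%:R * (j == l)%:R + (i == l)%:R * (j == k)%:R).

Definition actC (xi : 'M[R]_d) : 'M[R]_d :=
  \matrix_(i, j) \sum_k \sum_l tensorC i j k l * xi k l.

Definition positiveC : Prop :=
  exists2 c : R, 0 < c & forall xi : 'M[R]_d, xi^T = xi ->
    c * (\sum_i \sum_j xi i j ^+ 2) <=
    \sum_i \sum_j \sum_k \sum_l tensorC i j k l * xi i j * xi k l.

End tensor.

Section energy.
Context (R : realType) (d : nat) (Omega : set 'rV[R]_d) (lam mu : R).

Definition sigma (u : 'rV[R]_d -> 'rV[R]_d) (phi : 'rV[R]_d -> 'M[R]_d) :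
    'rV[R]_d -> 'M[R]_d :=
  fun x => actC lam mu (symgrad Omega u x - phi x).

Definition ipC (phi psi : 'rV[R]_d -> 'M[R]_d) : R :=
  ip (vol d) Omega (fun x => actC lam mu (phi x)) psi.

Definition normC (phi : 'rV[R]_d -> 'M[R]_d) : R := Num.sqrt (ipC phi phi).

Definition load (Gamma1 : set 'rV[R]_d)
    (gam : ('rV[R]_d -> 'rV[R]_d) -> 'rV[R]_d -> 'rV[R]_d)
    (f q v : 'rV[R]_d -> 'rV[R]_d) : R :=
  ip (vol d) Omega f v + ip (surf d) Gamma1 q (gam v).

Definition energy (alpha : R) (ell : ('rV[R]_d -> 'rV[R]_d) -> R)
    (u : 'rV[R]_d -> 'rV[R]_d) (phi : 'rV[R]_d -> 'M[R]_d) : R :=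
  2^-1 * normC (symgrad Omega u - phi) ^+ 2
  + alpha / 2 * norm2 (vol d) Omega phi ^+ 2 - ell u.

End energy.

(* [min_on A F] is the minimum of [F] on [A] when it is attained, 0 otherwise *)
Definition min_on (R : realType) (T : Type) (A : set T) (F : T -> R) : R :=
  xget 0 [set m | (exists2 v, A v & F v = m) /\ forall v, A v -> m <= F v].

Definition gateaux (R : realType) (V : lmodType R) (F : V -> R) (x y : V) : R :=
  derive1 (fun eps : R => F (x + eps *: y)) 0.

Definition gateaux_derivable (R : realType) (V : lmodType R) (F : V -> R)
    (x y : V) : Prop :=
  derivable (fun eps : R => F (x + eps *: y)) 0 1.

(* only meant for [k > 0] *)
Definition Dtau (R : realType) (V : lmodType R) (tau : R) (rho : nat -> V)
    (k : nat) : V :=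
  tau^-1 *: (rho k - rho k.-1).

(* Main.v *)
Require Import Defs.
From mathcomp Require Import all_boot all_order all_algebra.
From mathcomp Require Import all_classical all_reals all_analysis.
From mathcomp Require Import measurable_realfun lra ring.

Set Implicit Arguments.
Unset Strict Implicit.
Unset Printing Implicit Defensive.

Import Order.TTheory GRing.Theory Num.Theory.
Import numFieldNormedType.Exports.

Local Open Scope classical_set_scope.
Local Open Scope ring_scope.

(** Along one step of the scheme everything follows from a single expansion. The
    energy is a quadratic form minus a linear load, so [energy_expand] gives, for a
    displacement [v], a displacement increment [z] and strains [phi], [psi],

      E (v + t z, phi + t psi) = E (v, phi)
        + t ((C (e[v] - phi), e[z] - psi) + alpha (phi, psi) - l z)
        + t^2 (1/2 |e[z] - psi|_C^2 + alpha/2 |psi|^2).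

    - With [t = 1] and [psi = 0], equilibrium kills the linear term and the quadratic
      one is nonnegative: a state in equilibrium minimises the energy for its own
      [phi] ([equilibrium_min]).
    - The state in equilibrium with [phi + t psi] is [u + t w], where [e[w]] is the
      C-orthogonal projection of [psi] on the discrete strains. Hence the reduced
      energy is, along a line, a quadratic polynomial in [t], whose linear
      coefficient is [alpha (phi, psi) - (sigma, psi)] since equilibrium removes
      [w] ([reduced_energy_derive]). The evolution law says that this is
      [- eta (D phi, psi)], which is the gradient flow structure.
    - With [t = 1] and the increment that leads from the new state back to the old
      one, the linear term is the dissipation [tau eta |D phi|^2], again by
      equilibrium and the evolution law, and the quadratic term is the numerical
      dissipation ([energy_step]).

    The projection [w] exists by [riesz_finite]: a piecewise affine map is
    determined by finitely many vertex values, and a positive semidefinite form on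
    a space of finite dimension represents every functional that vanishes on its
    null vectors.

    The remaining work makes these computations legitimate. Strains are chosen
    representatives of weak gradients, so linearity of [e] holds almost everywhere
    and rests on the uniqueness of weak gradients, that is, on the fundamental lemma
    of the calculus of variations ([ae0_of_orthogonal]): smooth bumps converge to
    indicators of boxes, boxes generate the Borel sets, and a Lebesgue-measurable set
    has a Borel hull ([box_hull]). Additivity of integrals requires the domain and
    the Neumann boundary to be measurable for the outer measures that define volume
    and surface; for both it suffices that the half-spaces bounded by coordinate
    hyperplanes are, which holds for volume because a hyperplane cuts a box into
    boxes, and for the Hausdorff measure because it is additive on sets at positive
    distance ([caratheodory_sublevel]). *)

(** * Borel sets are measurable for volume and for surface *)

Section metric_outer_measure.
Local Open Scope ereal_scope.
Context (R : realType) (T : Type) (mu : {outer_measure set T -> \bar R}).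
Variable f : T -> R.
Hypothesis mu_gap : forall (A : set T) (s t : R), (s < t)%R ->
  mu (A `&` [set x | (f x <= s)%R]) + mu (A `&` [set x | (t <= f x)%R]) <= mu A.

Let layer (c : nat -> R) (X : set T) k :=
  X `&` [set x | (c k.+1 <= f x)%R] `&` [set x | (f x <= c k)%R].

(* Odd layers are separated from each other by the even ones. *)
Let sum_odd_layers (c : nat -> R) X n : (forall k, (c k.+1 < c k)%R) ->
  \sum_(k < n) mu (layer c X k.*2.+1) <= mu (X `&` [set x | (c n.*2 <= f x)%R]).
Proof.
move=> cS; elim: n => [|n IH]; first by rewrite big_ord0 outer_measure_ge0.
rewrite big_ord_recr/= doubleS; apply: le_trans (mu_gap _ (cS n.*2)).
rewrite [leLHS]addeC; apply: leeD => //; apply: le_trans IH _.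
apply: le_outer_measure => x [Xx /= cx]; do 2?split => //=.
by rewrite (le_trans _ cx)// (le_trans (ltW (cS _)))// ltW.
Qed.

(** Caratheodory's criterion, for the function [f] in place of the distance to a
    set: the layers between the levels [a + 1/(n+1)] have summable measures, those
    of odd rank being separated and those of even rank too, so the part of a set
    above the level [a + 1/(N+1)] exhausts in measure the part above [a]. *)
Lemma caratheodory_sublevel (a : R) :
  mu.-caratheodory [set x | (f x <= a)%R].
Proof.
apply: le_caratheodory_measurable => X; set S := [set x | _].
have [->|Xfin] := eqVneq (mu X) +oo; first exact: leey.
have {}Xfin : mu X < +oo by rewrite ltey.
pose c n : R := (a + n.+1%:R^-1)%R.
have cS n : (c n.+1 < c n)%R.
  by rewrite /c ltrD2l ltf_pV2 ?posrE// ltr_nat.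
have ca n : (a < c n)%R by rewrite /c ltrDl.
pose r k := mu (layer c X k).
have r0 k : 0 <= r k by exact: outer_measure_ge0.
have rX k : r k <= mu X.
  by apply: le_outer_measure => x [[]].
have rsum n : \sum_(k < n.*2) r k.+1 = \sum_(k < n) r k.*2.+1 + \sum_(k < n) r k.*2.+2.
  elim: n => [|n IH]; first by rewrite !big_ord0 adde0.
  by rewrite doubleS !big_ord_recr/= IH -!addeA; congr (_ + _); rewrite addeCA.
have rfin : \sum_(k <oo) r k < +oo.
  apply: (@le_lt_trans _ _ (mu X + (mu X + mu X))); last first.
    by rewrite !lte_add_pinfty.
  apply: lime_le; first by apply: is_cvg_nneseries => k _ _; exact: r0.
  apply: nearW => n; rewrite big_mkord.
  apply: (@le_trans _ _ (\sum_(k < n.*2.+1) r k)).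
    by apply: (lee_sum_nneg_ord r xpredT) => //; rewrite -addnn ltnW// ltnS leq_addr.
  rewrite big_ord_recl; apply: leeD => //.
  under eq_bigr do rewrite lift0.
  rewrite rsum; apply: leeD.
    by apply: le_trans (sum_odd_layers _ _ cS) _; exact: le_outer_measure.
  apply: le_trans (@sum_odd_layers (fun k => c k.+1) X n _) _ => [k|].
    exact: cS.
  exact: le_outer_measure.
have tail := nneseries_tail_cvg rfin (fun k _ => r0 k).
have muXfin : mu X \is a fin_num by rewrite ge0_fin_numE// outer_measure_ge0.
have Xtail : mu X + \sum_(N <= k <oo) r k @[N --> \oo] --> mu X + 0.
  by apply: cvgeD => //; [rewrite fin_num_adde_defr|exact: cvg_cst].
rewrite adde0 in Xtail.
(* Above [a], a point lies above [c N] or in a layer of rank at least [N]. *)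
apply: (cvge_to_ge Xtail); apply: nearW => N.
apply: (@le_trans _ _ (mu (X `&` S) + (mu (X `&` [set x | (c N <= f x)%R])
   + \sum_(N <= k <oo) r k))); last first.
  by rewrite addeA; apply: leeD2r => //; exact: mu_gap.
apply: leeD => //.
apply: le_trans (leeD (lexx _) (outer_measure_sigma_subadditive_tail _ _ _)).
apply: le_trans (outer_measureU2 _ _ _).
apply: le_outer_measure => x [Xx /= /negP]; rewrite -ltNge => ax.
have [cNx|xcN] := leP (c N) (f x); first by left.
right.
have /ex_minnP[m cm mmin] : exists n, (c n <= f x)%R.
  have fa : (0 < f x - a)%R by rewrite subr_gt0.
  have [n] := ltr_add_invr fa; rewrite add0r => nx.
  by exists n; rewrite /c -lerBrDl ltW.
have Nm : (N < m)%N.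
  rewrite ltnNge; apply/negP => mN.
  have : (c N <= c m)%R.
    by rewrite /c lerD2l lef_pV2 ?posrE// ler_nat ltnS.
  by move=> /le_trans/(_ cm); rewrite leNgt xcN.
exists m.-1 => /=; first by apply/negP; rewrite -leqNgt; case: (m) Nm.
case: m => // m in cm mmin Nm *; split; first by split.
rewrite /= leNgt; apply/negP => /ltW /mmin; by rewrite ltnn.
Qed.

End metric_outer_measure.
Section cover_splitting.
Local Open Scope ereal_scope.
Context (R : realType) (T I : Type) (B : I -> set T) (c : I -> \bar R).
Hypothesis c_ge0 : forall i, 0 <= c i.

(** Each covering set is replaced by two, one for each part, at no extra cost. *)
Lemma cover_outer_split (S1 S2 : set T) :
  (forall i, exists i1 i2 : option I,
    [/\ B i `&` S1 `<=` cover_set B i1, B i `&` S2 `<=` cover_set B i2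
      & cover_cost c i1 + cover_cost c i2 <= c i]) ->
  forall A, cover_outer B c (A `&` S1) + cover_outer B c (A `&` S2) <=
            cover_outer B c A.
Proof.
move=> split_ A.
have {split_}[g Pg] : {g : option I -> option I * option I & forall i,
    [/\ cover_set B i `&` S1 `<=` cover_set B (g i).1,
        cover_set B i `&` S2 `<=` cover_set B (g i).2
      & cover_cost c (g i).1 + cover_cost c (g i).2 <= cover_cost c i]}.
  apply: (@choice _ _ (fun i k => [/\ cover_set B i `&` S1 `<=` cover_set B k.1,
        cover_set B i `&` S2 `<=` cover_set B k.2
      & cover_cost c k.1 + cover_cost c k.2 <= cover_cost c i])) => -[i|].
    by have [i1 [i2 ?]] := split_ i; exists (i1, i2).
  by exists (None, None); split => /=; rewrite ?set0I// adde0.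
apply: le_ereal_inf_tmp => _ [F /= AF <-].
have c0 i : 0 <= cover_cost c i by exact: cover_cost_ge0.
apply: (@le_trans _ _ (\sum_(k <oo) (cover_cost c (g (F k)).1 +
                                    cover_cost c (g (F k)).2))); last first.
  by apply: lee_nneseries => [k _ _|k _]; [exact: adde_ge0|have [] := Pg (F k)].
rewrite nneseriesD//; apply: leeD; apply: ereal_inf_lbound.
  exists (fun k => (g (F k)).1) => //= x [/AF[k _ Fkx] S1x].
  by exists k => //; have [+ _ _] := Pg (F k); apply.
exists (fun k => (g (F k)).2) => //= x [/AF[k _ Fkx] S2x].
by exists k => //; have [_ + _] := Pg (F k); apply.
Qed.

End cover_splitting.

Section lebesgue_halfspace.
Context (R : realType) (d : nat).

(** A coordinate hyperplane cuts a box into two boxes whose volumes add up. *)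
Lemma lebesgue_halfspace (j : 'I_d) (a : R) :
  (@lebesgue_outer R d).-caratheodory [set x | x ord0 j <= a].
Proof.
apply: (@le_caratheodory_measurable _ _ (@lebesgue_outer R d)) => A.
apply: cover_outer_split => [|p]; first exact: box_volume_ge0.
pose upd (v : 'rV[R]_d) t := \row_i (if i == j then t else v ord0 i).
exists (Some (p.1, upd p.2 (Num.min (p.2 ord0 j) a))).
exists (Some (upd p.1 (Num.max (p.1 ord0 j) a), p.2)); split => /=.
- move=> x [/= px xa] i; rewrite mxE; case: eqP => [->|_]; last exact: px.
  by rewrite le_min xa andbT; exact: px.
- move=> x [/= px /negP]; rewrite -ltNge => ax i.
  rewrite mxE; case: eqP => [->|_]; last exact: px.
  by rewrite ge_max (ltW ax) andbT; exact: px.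
- rewrite /box_volume /= -EFinD lee_fin.
  rewrite (bigD1 j)//= [X in _ + X <= _](bigD1 j)//= [leRHS](bigD1 j)//=.
  rewrite !mxE eqxx.
  under eq_bigr => i ij do rewrite mxE (negbTE ij).
  under [X in _ + _ * X]eq_bigr => i ij do rewrite mxE (negbTE ij).
  rewrite -mulrDl ler_wpM2r//.
    by rewrite prodr_ge0// => i _; rewrite le_max lexx.
  move: (p.1 ord0 j) (p.2 ord0 j) => l b.
  rewrite /Num.max /Num.min.
  by do ! case: ltP => ?; lra.
Qed.

End lebesgue_halfspace.

Section hausdorff_halfspace.
Local Open Scope ereal_scope.
Context (R : realType) (d s : nat).

Lemma coord_le_enorm (x : 'rV[R]_d) j : (`|x ord0 j| <= enorm x)%R.
Proof.
rewrite -sqrtr_sqr /enorm ler_wsqrtr// /Defs.dotmx big_ord1 (bigD1 j)//= -expr2.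
by rewrite lerDl sumr_ge0// => i _; rewrite -expr2 sqr_ge0.
Qed.

Lemma hausdorff_pre_anti (e1 e2 : {posnum R}) (A : set 'rV[R]_d) :
  (e1%:num <= e2%:num)%R -> hausdorff_pre s e2 A <= hausdorff_pre s e1 A.
Proof.
move=> e12; apply: le_ereal_inf_tmp => _ [F AF <-].
have sub (U : small_set d e1) : forall x y, sval U x -> sval U y ->
    (enorm (x - y) <= e2%:num)%R.
  by move=> x y Ux Uy; apply: le_trans e12; exact: (svalP U).
apply: ereal_inf_lbound.
exists (fun k => omap (fun U => exist _ (sval U) (sub U)) (F k)).
  by move=> x /AF[k _ Fkx]; exists k => //; case: (F k) Fkx.
by apply: eq_eseriesr => k _; case: (F k).
Qed.

(** A set of diameter less than the gap cannot meet both sides of it. *)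
Lemma hausdorff_pre_gap (e : {posnum R}) (j : 'I_d) (a b : R) (A : set 'rV[R]_d) :
  (e%:num < b - a)%R ->
  hausdorff_pre s e (A `&` [set x | (x ord0 j <= a)%R]) +
  hausdorff_pre s e (A `&` [set x | (b <= x ord0 j)%R]) <= hausdorff_pre s e A.
Proof.
move=> eab; apply: cover_outer_split => [|U]; first exact: small_cost_ge0.
have [[y [Uy ya]]|noU] := pselect (exists y, sval U y /\ (y ord0 j <= a)%R).
  exists (Some U), None; split; rewrite /= ?adde0//.
  move=> x [/= Ux bx].
  have := le_trans (coord_le_enorm _ j) (svalP U _ _ Ux Uy).
  rewrite !mxE => h; have := le_lt_trans (le_trans (ler_norm _) h) eab.
  by rewrite ltNge lerB.
exists None, (Some U); split; rewrite /= ?add0e//.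
by move=> x [/= Ux xa]; apply: noU; exists x.
Qed.

Lemma hausdorff_gap (j : 'I_d) (A : set 'rV[R]_d) (a b : R) : (a < b)%R ->
  hausdorff_outer s (A `&` [set x | (x ord0 j <= a)%R]) +
  hausdorff_outer s (A `&` [set x | (b <= x ord0 j)%R]) <= hausdorff_outer s A.
Proof.
move=> ab; set A1 := A `&` _; set A2 := A `&` _.
have [->|Afin] := eqVneq (hausdorff_outer s A) +oo; first exact: leey.
have fin (B : set 'rV[R]_d) : B `<=` A -> hausdorff_outer s B \is a fin_num.
  move=> BA; rewrite ge0_fin_numE; last exact: hausdorff_outer_ge0.
  by apply: le_lt_trans (le_hausdorff_outer _ BA) _; rewrite ltey.
have ab2 : (0 < (b - a) / 2)%R by rewrite divr_gt0// subr_gt0.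
have pre e1 e2 : hausdorff_pre s e1 A1 + hausdorff_pre s e2 A2 <=
                 hausdorff_outer s A.
  pose e := Num.min (Num.min e1 e2) (PosNum ab2).
  have ele : [/\ (e%:num <= e1%:num)%R, (e%:num <= e2%:num)%R
               & (e%:num < b - a)%R].
    have : (e%:num <= ((b - a) / 2))%R by rewrite /e !num_min !ge_min lexx !orbT.
    have : (e%:num <= e1%:num)%R by rewrite /e !num_min !ge_min lexx.
    have : (e%:num <= e2%:num)%R by rewrite /e !num_min !ge_min lexx !orbT.
    by move=> -> -> e3; split => //; lra.
  have [ee1 ee2 eab] := ele.
  apply: (@le_trans _ _ (hausdorff_pre s e A1 + hausdorff_pre s e A2)).
    by apply: leeD; exact: hausdorff_pre_anti.
  apply: (@le_trans _ _ (hausdorff_pre s e A)); first exact: hausdorff_pre_gap.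
  by apply: ereal_sup_ubound; exists e.
have prefin e B : B `<=` A -> hausdorff_pre s e B \is a fin_num.
  move=> BA; rewrite ge0_fin_numE; last first.
    by apply: cover_outer_ge0; exact: small_cost_ge0.
  apply: (@le_lt_trans _ _ (hausdorff_outer s B)).
    by apply: ereal_sup_ubound; exists e.
  by rewrite -ge0_fin_numE ?fin//; exact: hausdorff_outer_ge0.
have A1A : A1 `<=` A by move=> ? [].
have A2A : A2 `<=` A by move=> ? [].
rewrite -leeBrDr ?fin//; apply: ge_ereal_sup => _ [e1 _ <-].
rewrite leeBrDr ?fin// addeC -leeBrDr ?prefin//.
apply: ge_ereal_sup => _ [e2 _ <-].
by rewrite leeBrDr ?prefin// addeC.
Qed.

Lemma hausdorff_halfspace (j : 'I_d) (a : R) :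
  (@hausdorff_outer R d s).-caratheodory [set x | (x ord0 j <= a)%R].
Proof.
apply: (@caratheodory_sublevel _ _ (@hausdorff_outer R d s) (fun x => x ord0 j)).
by move=> A b c; exact: hausdorff_gap.
Qed.

End hausdorff_halfspace.

Section borel_caratheodory.
Context (R : realType) (d : nat).

Definition obox (p : 'rV[R]_d * 'rV[R]_d) : set 'rV[R]_d :=
  [set x | forall j, p.1 ord0 j < x ord0 j < p.2 ord0 j].

(** Boxes with rational corners, to write open sets as countable unions. *)
Definition rat_pair (p : 'rV[rat]_d * 'rV[rat]_d) : 'rV[R]_d * 'rV[R]_d :=
  (map_mx ratr p.1, map_mx ratr p.2).

Lemma open_rat_box (U : set 'rV[R]_d) x : open U -> U x ->
  exists p, obox (rat_pair p) x /\ box (rat_pair p) `<=` U.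
Proof.
move=> oU Ux; have /nbhs_ballP[e /= e0 eU] := open_nbhs_nbhs (conj oU Ux).
have lo j : exists q : rat, ratr q \in `]x ord0 j - e, x ord0 j[.
  by apply: rat_in_itvoo; rewrite ltrBlDr ltrDl.
have hi j : exists q : rat, ratr q \in `]x ord0 j, x ord0 j + e[.
  by apply: rat_in_itvoo; rewrite ltrDl.
have [p Pp] := choice lo; have [q Pq] := choice hi.
exists (\row_j p j, \row_j q j); split => [j|y /= yB] /=.
  rewrite !mxE; have := Pp j; have := Pq j; rewrite !in_itv/=.
  by move=> /andP[-> _] /andP[_ ->].
apply: eU; split => // i j; rewrite ord1 /ball/= ltr_distlC.
have := yB j; rewrite !mxE; have := Pp j; have := Pq j; rewrite !in_itv/=.
by move=> /andP[? ?] /andP[? ?] /andP[? ?]; apply/andP; split; lra.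
Qed.

Context (mu : {outer_measure set 'rV[R]_d -> \bar R}).
Hypothesis mu_halfspace : forall j a,
  mu.-caratheodory [set x : 'rV[R]_d | x ord0 j <= a].

Lemma open_caratheodory (U : set 'rV[R]_d) : open U -> mu.-cara.-measurable U.
Proof.
move=> oU.
pose hbox (p : 'rV[rat]_d * 'rV[rat]_d) : set 'rV[R]_d := \bigcap_(j in [set: 'I_d])
  ([set x | x ord0 j <= ratr (p.2 ord0 j)] `\` [set x | x ord0 j <= ratr (p.1 ord0 j)]).
have -> : U = \bigcup_(p in [set p | hbox p `<=` U]) hbox p.
  apply/seteqP; split => [x Ux|x [p /= pU px]]; last exact: pU.
  have [p [xp pU]] := open_rat_box oU Ux; exists p => /=.
    move=> y py; apply: pU => j; have [] := py j I; rewrite /= !mxE => -> /negP.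
    by rewrite -ltNge => /ltW ->.
  move=> j _; have := xp j; rewrite /= !mxE => /andP[xj1 xj2].
  by split; [exact: ltW|apply/negP; rewrite -ltNge].
rewrite bigcup_mkcond; apply: countable_bigcupT_measurable => // p.
case: ifP => _; last exact: measurable0.
apply: fin_bigcap_measurable => // j _.
by apply: measurableD; exact: mu_halfspace.
Qed.

Lemma closed_caratheodory (F : set 'rV[R]_d) : closed F -> mu.-cara.-measurable F.
Proof.
move=> cF; rewrite -[F]setCK; apply: measurableC; apply: open_caratheodory.
exact: closed_openC.
Qed.

Lemma continuous_caratheodory (f : 'rV[R]_d -> R) (D : set 'rV[R]_d) :
  continuous f -> mu.-cara.-measurable D ->
  measurable_fun (D : set (caratheodory_type mu)) f.
Proof.
move=> cf mD; apply: (measurable_funS (E := setT)) => //.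
apply: (measurability _ (RGenOpens.measurableE R)) => _ [_ [a [b ->]] <-].
rewrite setTI; apply: open_caratheodory.
by move/continuousP : cf; apply; exact: interval_open.
Qed.

End borel_caratheodory.
(** * The inner product of square integrable matrix fields *)

Section square_integrable_functions.
Context (dT : measure_display) (T : measurableType dT) (R : realType).
Context (mu : {measure set T -> \bar R}) (D : set T).
Hypothesis mD : measurable D.

Definition sq_integrable (a : T -> R) : Prop :=
  measurable_fun D a /\ mu.-integrable D (fun x => (a x ^+ 2)%:E).

Lemma sq_integrableM a b : sq_integrable a -> sq_integrable b ->
  mu.-integrable D (fun x => (a x * b x)%:E).
Proof.
move=> [ma ia] [mb ib].
apply: (le_integrable mD _ _ (integrableD mD ia ib)) => [|x Dx].
  by apply/measurable_EFinP; exact: measurable_funM.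
rewrite /= lee_fin normrM.
rewrite [leRHS]ger0_norm ?addr_ge0 ?sqr_ge0//.
rewrite -(real_normK (num_real (a x))) -(real_normK (num_real (b x))).
have := sqr_ge0 (`|a x| - `|b x|).
have : 0 <= `|a x| * `|b x| by rewrite mulr_ge0.
by nra.
Qed.

Lemma sq_integrableZ k a : sq_integrable a -> sq_integrable (fun x => k * a x).
Proof.
move=> [ma ia]; split; first exact: measurable_funM.
apply: (eq_integrable mD _ _ _ (integrableZl mD (k ^+ 2) ia)) => x _.
by rewrite exprMn EFinM.
Qed.

Lemma sq_integrableD a b : sq_integrable a -> sq_integrable b ->
  sq_integrable (fun x => a x + b x).
Proof.
move=> ha hb; have iab := sq_integrableM ha hb.
have [ma ia] := ha; have [mb ib] := hb.
split; first exact: measurable_funD.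
apply: (eq_integrable mD _ _ _ (integrableD mD (integrableD mD ia ib)
   (integrableD mD iab iab))) => x _ /=.
by rewrite -!EFinD; congr EFin; ring.
Qed.

Lemma sq_integrable0 : sq_integrable (fun=> 0).
Proof.
split; first exact: measurable_cst.
by rewrite expr0n; exact: integrable0.
Qed.

Lemma sq_integrable_sum I (s : seq I) (F : I -> T -> R) :
  (forall i, sq_integrable (F i)) -> sq_integrable (fun x => \sum_(i <- s) F i x).
Proof.
move=> hF; elim: s => [|i s IH].
  by under eq_fun do rewrite big_nil; exact: sq_integrable0.
by under eq_fun do rewrite big_cons; exact: sq_integrableD.
Qed.

Section matrix_valued.
Context (m n : nat).
Implicit Types f g h : T -> 'M[R]_(m, n).

Lemma L2_lin k f g : L2 mu D f -> L2 mu D g -> L2 mu D (k *: f + g).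
Proof.
move=> hf hg i j.
suff : sq_integrable (fun x => (k *: f + g) x i j) by [].
rewrite (_ : (fun x => _) = (fun x => k * f x i j + g x i j)).
  exact: sq_integrableD (sq_integrableZ k (hf i j)) (hg i j).
by apply/funext => x; rewrite !mxE.
Qed.

Lemma L2_zero : L2 mu D (0 : T -> 'M[R]_(m, n)).
Proof.
move=> i j; suff : sq_integrable (fun x => (0 : T -> 'M[R]_(m, n)) x i j) by [].
rewrite (_ : (fun x => _) = (fun=> 0)); first exact: sq_integrable0.
by apply/funext => x; rewrite mxE.
Qed.

Lemma L2Z k f : L2 mu D f -> L2 mu D (k *: f).
Proof. by move=> hf; rewrite -[_ *: _]addr0; apply: L2_lin => //; exact: L2_zero. Qed.

Lemma L2B f g : L2 mu D f -> L2 mu D g -> L2 mu D (f - g).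
Proof. by move=> hf hg; rewrite addrC -scaleN1r; exact: L2_lin. Qed.

Lemma integrable_dotmx f g : L2 mu D f -> L2 mu D g ->
  mu.-integrable D (fun x => (Defs.dotmx (f x) (g x))%:E).
Proof.
move=> hf hg; rewrite /Defs.dotmx.
under eq_fun do rewrite -sumEFin; apply: integrable_sum => // i _.
under eq_fun do rewrite -sumEFin; apply: integrable_sum => // j _.
exact: sq_integrableM.
Qed.

Lemma dotmxC (A B : 'M[R]_(m, n)) : Defs.dotmx A B = Defs.dotmx B A.
Proof. by apply: eq_bigr => i _; apply: eq_bigr => j _; rewrite mulrC. Qed.

Lemma dotmx_lin k (A B C : 'M[R]_(m, n)) :
  Defs.dotmx (k *: A + B) C = k * Defs.dotmx A C + Defs.dotmx B C.
Proof.
rewrite /Defs.dotmx mulr_sumr -big_split; apply: eq_bigr => i _.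
rewrite mulr_sumr -big_split; apply: eq_bigr => j _.
by rewrite !mxE mulrDl mulrA.
Qed.

Lemma ip_sym f g : ip mu D f g = ip mu D g f.
Proof. by apply: eq_Rintegral => x _; exact: dotmxC. Qed.

Lemma ip_linl k f g h : L2 mu D f -> L2 mu D g -> L2 mu D h ->
  ip mu D (k *: f + g) h = k * ip mu D f h + ip mu D g h.
Proof.
move=> hf hg hh; rewrite /ip.
under eq_Rintegral do rewrite dotmx_lin.
have ifh := integrable_dotmx hf hh; have igh := integrable_dotmx hg hh.
rewrite RintegralD//; first by rewrite RintegralZl.
apply: (eq_integrable mD _ _ _ (integrableZl mD k ifh)) => x _ /=.
by rewrite EFinM.
Qed.

Lemma ip0l g : L2 mu D g -> ip mu D 0 g = 0.
Proof.
move=> hg; have := ip_linl 1 L2_zero L2_zero hg.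
by rewrite scaler0 addr0 mul1r => /eqP; rewrite -subr_eq0 opprD addNKr oppr_eq0 => /eqP.
Qed.

Lemma ip_scalel k f g : L2 mu D f -> L2 mu D g ->
  ip mu D (k *: f) g = k * ip mu D f g.
Proof.
by move=> hf hg; have := ip_linl k hf L2_zero hg; rewrite addr0 ip0l// addr0.
Qed.

Lemma ip_linr k f g h : L2 mu D f -> L2 mu D g -> L2 mu D h ->
  ip mu D h (k *: f + g) = k * ip mu D h f + ip mu D h g.
Proof. by move=> hf hg hh; rewrite ip_sym ip_linl// ![ip _ _ h _]ip_sym. Qed.

Lemma ip_ae f f' g g' : L2 mu D f -> L2 mu D f' -> L2 mu D g -> L2 mu D g' ->
  f = f' %[ae mu in D] -> g = g' %[ae mu in D] -> ip mu D f g = ip mu D f' g'.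
Proof.
move=> hf hf' hg hg' ff' gg'; congr fine; apply: ae_eq_integral => //.
- by case/integrableP : (integrable_dotmx hf hg).
- by case/integrableP : (integrable_dotmx hf' hg').
- by apply: filterS2 ff' gg' => x fx gx Dx; rewrite fx// gx.
Qed.

Lemma dotmx_ge0 (A : 'M[R]_(m, n)) : 0 <= Defs.dotmx A A.
Proof. by do 2!apply: sumr_ge0 => ? _; rewrite -expr2 sqr_ge0. Qed.

Lemma norm2_sqr f : norm2 mu D f ^+ 2 = ip mu D f f.
Proof. by rewrite sqr_sqrtr// Rintegral_ge0// => x _; exact: dotmx_ge0. Qed.

End matrix_valued.
End square_integrable_functions.
(** * Smooth functions *)

Section flat_functions.
Context (R : realType).
Implicit Types (P : {poly R}) (x y : R).

(** The factor [P.[1 / x]] makes this family closed under differentiation; its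
    member [flat 1] is the usual smooth function that is flat at 0. *)
Definition flat P (x : R) : R :=
  if 0 < x then P.[x^-1] * expR (- x^-1) else 0.

Definition flat_deriv P : {poly R} := 'X^2 * (P - P^`()).

Lemma poly_le_expR P : exists2 C, 0 <= C & forall y, 0 <= y ->
  `|P.[y]| <= C * expR y.
Proof.
exists (\sum_(i < size P) `|P`_i| * i%:R ^+ i) => [|y y0].
  by apply: sumr_ge0 => i _; rewrite mulr_ge0// exprn_ge0.
rewrite horner_coef (le_trans (ler_norm_sum _ _ _))// mulr_suml.
apply: ler_sum => i _; rewrite normrM -mulrA ler_wpM2l// normrX (ger0_norm y0).
have [->|i0] := eqVneq (val i) 0%N.
  by rewrite !expr0 mul1r; apply: le_trans (expR_ge1Dx _); rewrite lerDl.
have in0 : (i : nat)%:R != 0 :> R by rewrite pnatr_eq0.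
have -> : y = i%:R * (y / i%:R) by rewrite mulrC divfK.
rewrite expRM_natl exprMn ler_wpM2l ?exprn_ge0//.
rewrite lerXn2r ?nnegrE ?expR_ge0 ?divr_ge0//.
by apply: le_trans (expR_ge1Dx _); rewrite lerDr.
Qed.

Lemma is_derive_flat P x : is_derive x 1 (flat P) (flat (flat_deriv P) x).
Proof.
have [x0|x0|<-] := ltgtP 0 x.
- have xn0 : x != 0 by rewrite gt_eqF.
  have dV : is_derive x 1 (fun y : R => y^-1) (- x ^- 2).
    have := @is_deriveV R id x 1 1 xn0 (is_derive_id _ _).
    by move/is_derive_eq; apply; rewrite -[_ *: _]/(_ * _) mulr1.
  have dP : is_derive (x^-1) 1 (horner P) P^`().[x^-1].
    apply: DeriveDef; first exact: derivable_horner.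
    by rewrite -derive1E -derivE.
  have dPV : is_derive x 1 (fun y => P.[y^-1]) (P^`().[x^-1] * - x ^- 2).
    exact: (@is_derive1_comp R (horner P) (fun y : R => y^-1)).
  have dE : is_derive x 1 (fun y => expR (- y^-1)) (expR (- x^-1) * x ^- 2).
    have dN : is_derive x 1 (fun y : R => - y^-1) (x ^- 2).
      by have := is_deriveN dV; rewrite opprK.
    exact: (@is_derive1_comp R (@expR R) (fun y => - y^-1)).
  have := is_deriveM dPV dE => /(@near_eq_is_derive _ _ _ _ (flat P)) h.
  have -> : flat (flat_deriv P) x = (fun y : R => P.[y^-1]) x *: (expR (- x^-1) * x ^- 2)
      + (fun y => expR (- y^-1)) x *: (P^`().[x^-1] * - x ^- 2).
    rewrite /flat x0 /flat_deriv !hornerE /= -![_ *: _]/(_ * _) exprVn.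
    by ring.
  apply: h; near=> y.
  by rewrite /flat ifT//; near: y; exact: lt_nbhsr.
- have := is_derive_cst (0 : R) x 1 => /(@near_eq_is_derive _ _ _ _ (flat P)) h.
  rewrite {2}/flat ltNge (ltW x0)/=.
  apply: h; near=> y.
  rewrite /flat ltNge ifF//; apply/negbTE; rewrite negbK ltW//.
  by near: y; exact: lt_nbhsl.
- rewrite {2}/flat ltxx.
  (* With the factor ['X^2] the bound reads [|flat P h| <= C h^2]. *)
  have [C C0 PC] := poly_le_expR ('X^2 * P).
  have bnd h : `|flat P h| <= C * h ^+ 2.
    rewrite /flat; case: ifPn => [h0|_]; last by rewrite normr0 mulr_ge0// sqr_ge0.
    have := PC h^-1; rewrite invr_ge0 (ltW h0) => /(_ isT).
    rewrite hornerM hornerXn normrM (ger0_norm (sqr_ge0 _)) exprVn.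
    rewrite ler_pdivrMl ?exprn_gt0// => hC.
    rewrite normrM (ger0_norm (expR_ge0 _)) expRN ler_pdivrMr ?expR_gt0//.
    by apply: le_trans hC _; rewrite mulrCA mulrA.
  have lim0 : h^-1 *: ((flat P \o shift 0) (h *: 1) - flat P 0) @[h --> 0^'] --> (0 : R).
    apply/cvgr0Pnorm_le => _/posnumP[e]; near=> h.
    have hn0 : h != 0 by near: h; exact: nbhs_dnbhs_neq.
    rewrite /= addr0 -![_ *: _]/(_ * _) mulr1 {2}/flat ltxx subr0 normrM normfV.
    rewrite ler_pdivrMl ?normr_gt0//; apply: le_trans (bnd h) _.
    rewrite -real_normK ?num_real// expr2 mulrCA ler_wpM2l//.
    have : `|h| <= e%:num / (C + 1).
      near: h; apply: dnbhs0_le; rewrite divr_gt0//; lra.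
    rewrite ler_pdivlMr; last lra.
    by move=> ?; have := normr_ge0 h; nra.
  apply: DeriveDef; first by apply/cvg_ex; exists 0.
  exact: cvg_lim lim0.
Unshelve. all: by end_near. Qed.

Lemma continuous_flat P : continuous (flat P).
Proof.
move=> x; apply: differentiable_continuous; apply/derivable1_diffP.
by have [] := is_derive_flat P x.
Qed.

Lemma flat1_ge0 x : 0 <= flat 1 x.
Proof. by rewrite /flat; case: ifP => // _; rewrite hornerC mul1r expR_ge0. Qed.

Lemma flat1_le1 x : flat 1 x <= 1.
Proof.
rewrite /flat; case: ifPn => [x0|//]; rewrite hornerC mul1r -expR0 ler_expR.
by rewrite lerNl oppr0 invr_ge0 ltW.
Qed.

Lemma flat1_le0 x : x <= 0 -> flat 1 x = 0.
Proof. by rewrite /flat ltNge => ->. Qed.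

(** Dilating the argument turns [flat 1] into the indicator of the positive
    half-line. *)
Lemma cvg_flat1 (x : R) :
  flat 1 (n.+1%:R * x) @[n --> \oo] --> ((0 < x)%R%:R : R).
Proof.
have [x0|x0] := ltP 0 x; last first.
  under eq_fun do rewrite flat1_le0 ?mulr_ge0_le0//.
  exact: cvg_cst.
under eq_fun => n do rewrite /flat mulr_gt0// hornerC mul1r invfM.
have <- : expR 0 = 1%:R :> R by rewrite expR0.
apply: continuous_cvg; first exact: continuous_expR.
rewrite -oppr0; apply: cvgN; rewrite -(mul0r x^-1).
by apply: cvgMr_tmp; exact: cvg_harmonic.
Qed.

End flat_functions.

Section smooth_functions.
Context (R : realType) (d : nat).
Implicit Types f g : 'rV[R]_d -> R.

Lemma class_C_cst k (a : R) : class_C k (fun _ : 'rV[R]_d => a).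
Proof.
elim: k a => [|k IH] a; (split; first exact: cst_continuous) => //.
move=> j; split; first by move=> x; exact: derivable_cst.
rewrite (_ : partial j _ = fun=> 0)//.
by apply/funext => x; rewrite /partial derive_cst.
Qed.

Lemma class_C_pred k f : class_C k.+1 f -> class_C k f.
Proof.
elim: k f => [|k IH] f [cf df]; split=> // j.
by have [? /IH ?] := df j.
Qed.

Lemma class_CD k f g : class_C k f -> class_C k g ->
  class_C k (fun x => f x + g x).
Proof.
elim: k f g => [|k IH] f g [cf df] [cg dg]; 
  (split; first by move=> x; exact: (cvgD (cf x) (cg x))) => //.
move=> j; have [dfj Cf] := df j; have [dgj Cg] := dg j; split.
  by move=> x; exact: (derivableD (dfj x) (dgj x)).
rewrite (_ : partial j _ = fun x => partial j f x + partial j g x).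
  exact: IH.
by apply/funext => x; rewrite /partial (deriveD (dfj x) (dgj x)).
Qed.

Lemma class_CM k f g : class_C k f -> class_C k g ->
  class_C k (fun x => f x * g x).
Proof.
elim: k f g => [|k IH] f g Cf Cg; have [cf df] := Cf; have [cg dg] := Cg; 
  (split; first by move=> x; exact: (cvgM (cf x) (cg x))) => //.
move=> j; have [dfj Cfj] := df j; have [dgj Cgj] := dg j; split.
  by move=> x; exact: (derivableM (dfj x) (dgj x)).
rewrite (_ : partial j _ = fun x => f x * partial j g x + g x * partial j f x).
  by apply: class_CD; apply: IH => //; exact: class_C_pred.
by apply/funext => x; rewrite /partial (deriveM (dfj x) (dgj x)).
Qed.

Lemma class_CZ k (a : R) f : class_C k f -> class_C k (fun x => a * f x).
Proof. exact: class_CM (class_C_cst k a). Qed.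

Lemma class_C_prod k I (s : seq I) (F : I -> 'rV[R]_d -> R) :
  (forall i, class_C k (F i)) -> class_C k (fun x => \prod_(i <- s) F i x).
Proof.
move=> CF; elim: s => [|i s IH].
  by under eq_fun do rewrite big_nil; exact: class_C_cst.
by under eq_fun do rewrite big_cons; exact: class_CM.
Qed.

Lemma is_derive_flat_coord P (c e : R) (i j : 'I_d) x :
  is_derive x (delta_mx ord0 j : 'rV[R]_d) (fun x => flat P (c * x ord0 i + e))
    (c * (i == j)%:R * flat (flat_deriv P) (c * x ord0 i + e)).
Proof.
set v : 'rV_d := delta_mx _ _; set f := fun x : 'rV_d => _.
set b := c * (i == j)%:R.
pose l (h : R) := b * h + (c * x ord0 i + e).
have fE : (fun h : R => f (h *: v + x)) = flat P \o l.
  apply/funext => h; rewrite /f /l /= !mxE eqxx /= eq_sym.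
  by congr flat; rewrite /b eq_sym; ring.
have dl : is_derive (0 : R) 1 l b.
  have h : is_derive (0 : R) (1 : R) (b \*: (@idfun R) + cst (c * x ord0 i + e))
    (b *: (1 : R) + 0) by exact: _.
  by move: h; rewrite addr0 -[_ *: _]/(_ * _) mulr1.
have dfl : is_derive (0 : R) 1 (flat P \o l) (flat (flat_deriv P) (l 0) * b).
  exact: (@is_derive1_comp R (flat P) l 0 _ _ (is_derive_flat P (l 0)) dl).
have [dfl1 dfl2] := dfl.
apply: DeriveDef; first by refine ((derivable1P f x v).2 _); rewrite fE.
transitivity ('D_1 (flat P \o l) 0).
  rewrite /derive -fE; set g1 := fun h => _; set g2 := fun h => _.
  suff -> : g1 = g2 by []; apply/funext => h; rewrite /g1 /g2 /=.
  by rewrite addr0 -[h *: 1]/(h * 1) mulr1 scale0r add0r.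
by rewrite dfl2 mulrC /l mulr0 add0r.
Qed.

Lemma class_C_flat_coord k P (c e : R) (i : 'I_d) :
  class_C k (fun x => flat P (c * x ord0 i + e)).
Proof.
have cont P' : continuous (fun x : 'rV[R]_d => flat P' (c * x ord0 i + e)).
  move=> x; apply: (@continuous_comp _ _ _
    (fun x : 'rV[R]_d => c * x ord0 i + e) (flat P')); last first.
    exact: continuous_flat.
  exact: (cvgD (cvgM (cvg_cst _) (@coord_continuous _ _ _ _ _ x)) (cvg_cst _)).
elim: k P => [|k IH] P; split => // j.
have dj x := is_derive_flat_coord P c e i j x.
split; first by move=> x; have [] := dj x.
rewrite (_ : partial j _ = fun x => c * (i == j)%:R *
    flat (flat_deriv P) (c * x ord0 i + e)); first exact: class_CZ.
by apply/funext => x; have [] := dj x.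
Qed.

End smooth_functions.
(** * Boxes and Borel hulls *)

Section lebesgue_hull.
Local Open Scope ereal_scope.
Context (R : realType) (d : nat).
Local Notation leb := (@lebesgue_outer R d).
Implicit Types A U : set 'rV[R]_d.

Lemma vol_open_measurable U : open U -> leb.-cara.-measurable U.
Proof. exact: (open_caratheodory (mu := leb) (@lebesgue_halfspace R d)). Qed.

Lemma compact_box p : compact (@box R d p).
Proof.
rewrite (_ : box p = [set v : 'rV[R]_d |
    forall i, `[p.1 ord0 i, p.2 ord0 i]%classic (v ord0 i)]).
  apply: (@rV_compact _ _ (fun i => `[p.1 ord0 i, p.2 ord0 i]%classic)) => i.
  exact: segment_compact.
by apply/seteqP; split => x px i; have := px i; rewrite /= in_itv/=.
Qed.

Lemma closed_box p : closed (@box R d p).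
Proof. by apply: compact_closed; [exact: norm_hausdorff|exact: compact_box]. Qed.

Lemma open_obox p : open (@obox R d p).
Proof.
rewrite openE => x px.
suff : forall j, \forall y \near x, (p.1 ord0 j < (y : 'rV[R]_d) ord0 j < p.2 ord0 j)%R.
  by move/filter_forall.
move=> j.
have : open_nbhs x ((fun y : 'rV[R]_d => y ord0 j) @^-1`
    `]p.1 ord0 j, p.2 ord0 j[%classic).
  split; last by rewrite /= in_itv/=; exact: px.
  by apply: open_comp => [y _|]; [exact: coord_continuous|exact: interval_open].
by move/open_nbhs_nbhs; apply: filterS => y; rewrite /= in_itv.
Qed.

Lemma box_measurable p : leb.-cara.-measurable (@box R d p).
Proof.
have h := closed_caratheodory (@lebesgue_halfspace R d) (closed_box (p := p)).
exact h.
Qed.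

Lemma setI_closed_box : setI_closed [set B | exists p, B = @box R d p].
Proof.
move=> _ _ [p ->] [q ->].
exists (\row_j Num.max (p.1 ord0 j) (q.1 ord0 j),
  \row_j Num.min (p.2 ord0 j) (q.2 ord0 j))%R.
apply/seteqP; split => [x [px qx] j|x pqx].
  rewrite /= !mxE ge_max le_min.
  by have /andP[-> ->] := px j; have /andP[-> ->] := qx j.
split=> j; have := pqx j; rewrite /= !mxE ge_max le_min;
  by move=> /andP[/andP[? ?] /andP[? ?]]; apply/andP.
Qed.

Lemma leb_cover_set (i : option ('rV[R]_d * 'rV[R]_d)) :
  leb (cover_set (@box R d) i) <= cover_cost (@box_volume R d) i.
Proof.
apply: ereal_inf_lbound; exists (fun k => if k == 0%N then i else None) => /=.
  by move=> x ix; exists 0%N.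
rewrite nneseries_recl//=; last first.
  by move=> k _; apply: cover_cost_ge0; exact: box_volume_ge0.
by rewrite eseries_cond eseries0 ?adde0// => -[].
Qed.

Lemma bounded_sub_box A : bounded_set A -> exists p, A `<=` @box R d p.
Proof.
move=> [M [_ AM]]; exists (const_mx (- (M + 1)), const_mx (M + 1))%R.
move=> x Ax j; rewrite /= !mxE -ler_norml.
apply: le_trans (AM (M + 1)%R _ x Ax); last by rewrite ltrDl.
rewrite [leRHS]/Num.norm/= mx_normrE.
by apply: (@le_bigmax _ _ _ 0%R (fun ij => `|x ij.1 ij.2|%R) (ord0, j)).
Qed.

Lemma vol_bounded A : bounded_set A -> vol d A < +oo.
Proof.
move=> /bounded_sub_box[p Ap].
apply: (@le_lt_trans _ _ (leb (box p))); first exact: le_outer_measure.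
apply: (le_lt_trans (leb_cover_set (Some p))).
by rewrite /= /box_volume ltry.
Qed.

(** Almost optimal countable covers by boxes, intersected, give a set of the
    Borel algebra that exceeds a Lebesgue-measurable set by a null set. *)
Lemma box_hull A : leb.-cara.-measurable A -> leb A < +oo ->
  exists D, [/\ <<s [set B | exists p, B = @box R d p] >> D, A `<=` D
              & leb (D `\` A) = 0].
Proof.
move=> mA Afin; set G := [set B | _].
have Afn : leb A \is a fin_num by rewrite ge0_fin_numE// outer_measure_ge0.
have cov n : exists F : nat -> option ('rV[R]_d * 'rV[R]_d),
    A `<=` \bigcup_k cover_set (@box R d) (F k) /\
    \sum_(k <oo) cover_cost (@box_volume R d) (F k) < leb A + (n.+1%:R^-1)%:E.
  have n0 : (0 < n.+1%:R^-1 :> R)%R by rewrite invr_gt0.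
  have [_ [F AF <-] Fn] := lb_ereal_inf_adherent n0 Afn.
  by exists F.
have {cov}[F FA] := choice cov.
pose D := \bigcap_n \bigcup_k cover_set (@box R d) (F n k).
have GD : <<s G >> D.
  rewrite -[D]setCK setC_bigcap; apply: sigma_algebraC.
  apply: sigma_algebra_bigcup => n; apply: sigma_algebraC.
  apply: sigma_algebra_bigcup => k.
  case: (F n k) => [p|] /=; last exact: sigma_algebra0.
  by apply: sub_gen_smallest; exists p.
have AD : A `<=` D by move=> x Ax n _; exact: (FA n).1.
exists D; split => //.
have DA : leb D <= leb A.
  apply/lee_addgt0Pr => e e0.
  have [n] := ltr_add_invr e0; rewrite add0r => ne.
  apply: (@le_trans _ _ (leb A + (n.+1%:R^-1)%:E)); last first.
    by apply: leeD2l; rewrite lee_fin ltW.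
  apply: le_trans (ltW (FA n).2).
  apply: le_trans (le_outer_measure leb _ _ (bigcap_inf (i := n) I)) _.
  apply: le_trans (outer_measure_sigma_subadditive leb _) _.
  apply: lee_nneseries => [k _ _|k _]; first exact: outer_measure_ge0.
  exact: leb_cover_set.
have := mA D; rewrite (setIidr AD) => E.
have DAfn : leb (D `&` ~` A) \is a fin_num.
  rewrite ge0_fin_numE ?outer_measure_ge0//; apply: le_lt_trans Afin.
  by apply: le_trans DA; exact: le_outer_measure.
apply/eqP; rewrite eq_le outer_measure_ge0 andbT setDE.
by move: DA; rewrite E -leeBrDl// subee.
Qed.

End lebesgue_hull.
(** * The fundamental lemma of the calculus of variations *)

Section bump_functions.
Context (R : realType) (d : nat).
Implicit Types (p : 'rV[R]_d * 'rV[R]_d) (x : 'rV[R]_d).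

(** Smooth approximations, from inside, of the indicator of an open box. *)
Definition inner_bump p n x : R := \prod_(j < d)
  (flat 1 (n.+1%:R * (x ord0 j - p.1 ord0 j)) *
   flat 1 (n.+1%:R * (p.2 ord0 j - x ord0 j))).

(** Smooth approximations, from outside, of the indicator of a closed box. Only the
    product with an [inner_bump] is compactly supported; the two kinds together
    reach all sets [obox p `&` box q], and the closed boxes [box q] form a
    pi-system. *)
Definition outer_bump p n x : R := \prod_(j < d)
  ((1 - flat 1 (n.+1%:R * (p.1 ord0 j - x ord0 j))) *
   (1 - flat 1 (n.+1%:R * (x ord0 j - p.2 ord0 j)))).

Let class_C_flat_shift k (c a : R) (j : 'I_d) :
  class_C k (fun x => flat 1 (c * (x ord0 j - a))).
Proof.
have := class_C_flat_coord k 1 c (- (c * a)) j.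
by under eq_fun do rewrite -mulrBr.
Qed.

Let class_C_flat_shiftN k (c a : R) (j : 'I_d) :
  class_C k (fun x => flat 1 (c * (a - x ord0 j))).
Proof.
have := class_C_flat_coord k 1 (- c) (c * a) j.
by under eq_fun do rewrite mulNr addrC -mulrBr.
Qed.

Lemma class_C_inner_bump k p n : class_C k (inner_bump p n).
Proof. by apply: class_C_prod => j; apply: class_CM. Qed.

Lemma class_C_outer_bump k p n : class_C k (outer_bump p n).
Proof.
have compl f : class_C k f -> class_C k (fun x : 'rV[R]_d => 1 - f x).
  move=> Cf; have := class_CD (class_C_cst d k 1) (class_CZ (-1) Cf).
  by under eq_fun do rewrite mulN1r.
by apply: class_C_prod => j; apply: class_CM; exact: compl.
Qed.

Let prod_itv (F : 'I_d -> R) : (forall j, 0 <= F j <= 1) ->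
  0 <= \prod_(j < d) F j <= 1.
Proof.
move=> F01; apply/andP; split; last exact: Num.Theory.prodr_ile1.
by apply: prodr_ge0 => j _; case/andP : (F01 j).
Qed.

Lemma inner_bump_itv p n x : 0 <= inner_bump p n x <= 1.
Proof.
by apply: prod_itv => j; rewrite mulr_ge0 ?flat1_ge0// mulr_ile1 ?flat1_ge0 ?flat1_le1.
Qed.

Lemma outer_bump_itv p n x : 0 <= outer_bump p n x <= 1.
Proof.
apply: prod_itv => j.
have h (y : R) : 0 <= 1 - flat 1 y <= 1.
  by rewrite subr_ge0 flat1_le1 lerBlDr lerDl flat1_ge0.
have /andP[h1 h2] := h (n.+1%:R * (p.1 ord0 j - x ord0 j)).
have /andP[h3 h4] := h (n.+1%:R * (x ord0 j - p.2 ord0 j)).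
by rewrite mulr_ge0// mulr_ile1.
Qed.

Lemma inner_bump_supp p n x : inner_bump p n x != 0 -> obox p x.
Proof.
rewrite prodf_seq_neq0 => /allP/= h j; have := h j (mem_index_enum _) => /=.
rewrite mulf_eq0; apply: contraNT => /nandP[]; rewrite -leNgt => xp.
  by rewrite flat1_le0 ?eqxx// mulr_ge0_le0// subr_le0.
by rewrite orbC flat1_le0 ?eqxx// mulr_ge0_le0// subr_le0.
Qed.

Let prod_indic (b : 'I_d -> bool) :
  \prod_(j < d) (b j)%:R = [forall j, b j]%:R :> R.
Proof.
have [/forallP ball|/forallPn[j bj]] := boolP [forall j, b j].
  by rewrite big1// => j _; rewrite ball.
by rewrite (bigD1 j)//= (negbTE bj) mul0r.
Qed.

Lemma cvg_inner_bump p x : inner_bump p n x @[n --> \oo] --> (\1_(obox p) x : R).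
Proof.
have -> : (\1_(obox p) x : R) = \prod_(j < d)
    ((0 < x ord0 j - p.1 ord0 j)%R%:R * (0 < p.2 ord0 j - x ord0 j)%R%:R).
  under eq_bigr do rewrite -natrM mulnb !subr_gt0.
  rewrite prod_indic indicE; congr (nat_of_bool _)%:R.
  by apply/idP/forallP; rewrite inE.
by apply: cvg_big => [|j _]; [exact: mul_continuous|apply: cvgM; exact: cvg_flat1].
Qed.

Lemma cvg_outer_bump p x : outer_bump p n x @[n --> \oo] --> (\1_(box p) x : R).
Proof.
have -> : (\1_(box p) x : R) = \prod_(j < d)
    ((1 - (0 < p.1 ord0 j - x ord0 j)%R%:R) * (1 - (0 < x ord0 j - p.2 ord0 j)%R%:R)).
  have E (u v : R) : 1 - (0 < u - v)%R%:R = (u <= v)%R%:R :> R.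
    by rewrite subr_gt0 ltNge; case: (u <= v)%R; rewrite ?subr0 ?subrr.
  under eq_bigr do rewrite !E -natrM mulnb.
  rewrite prod_indic indicE; congr (nat_of_bool _)%:R.
  by apply/idP/forallP; rewrite inE.
apply: cvg_big => [|j _]; first exact: mul_continuous.
by apply: cvgM; apply: cvgB; [exact: cvg_cst|exact: cvg_flat1|
  exact: cvg_cst|exact: cvg_flat1].
Qed.

Lemma test_function_bump (Omega : set 'rV[R]_d) p q n : box p `<=` Omega ->
  test_function Omega (fun x => inner_bump p n x * outer_bump q n x).
Proof.
move=> pO; set f := fun x => _.
have supp : closure [set x | f x != 0] `<=` box p.
  have /closure_id-> := closed_box (p := p).
  apply: closure_subset => x /=; rewrite mulf_eq0 negb_or => /andP[+ _].
  by move=> /inner_bump_supp px j; have /andP[/ltW-> /ltW->] := px j.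
split; last exact: subset_trans pO.
  by move=> k; apply: class_CM; [exact: class_C_inner_bump|exact: class_C_outer_bump].
by apply: subclosed_compact (compact_box (p := p)) supp; exact: closed_closure.
Qed.

End bump_functions.
Section zero_integrals.
Local Open Scope ereal_scope.
Context (dT : measure_display) (T : measurableType dT) (R : realType).
Context (mu : {measure set T -> \bar R}) (Q : set T) (h : T -> R).
Hypothesis mQ : measurable Q.
Hypothesis ih : mu.-integrable Q (fun x => (h x)%:E).
Hypothesis h0 : \int[mu]_(x in Q) (h x)%:E = 0.

Let ihS B : measurable B -> B `<=` Q -> mu.-integrable B (fun x => (h x)%:E).
Proof. by move=> mB BQ; exact: integrableS ih. Qed.

Let mhS B : B `<=` Q -> measurable_fun B h.
Proof.
move=> BQ; case/integrableP : ih => /measurable_EFinP mh _.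
exact: measurable_funS mh.
Qed.

Let integral_diff A : measurable A -> A `<=` Q ->
  \int[mu]_(x in A) (h x)%:E = 0 -> \int[mu]_(x in Q `\` A) (h x)%:E = 0.
Proof.
move=> mA AQ hA; have : \int[mu]_(x in A `|` (Q `\` A)) (h x)%:E = 0.
  by rewrite setDUK.
rewrite integral_setU//=; first by rewrite hA add0e.
- exact: measurableD.
- by apply/measurable_EFinP/mhS; rewrite setDUK.
- by apply/eqP; rewrite setDIK.
Qed.

Lemma dynkin_zero_integral :
  dynkin [set A | measurable A /\ \int[mu]_(x in Q `&` A) (h x)%:E = 0].
Proof.
split.
- by split; [exact: measurableT|rewrite setIT].
- move=> B [mB hB]; split; first exact: measurableC.
  have -> : Q `&` ~` B = Q `\` (Q `&` B) by rewrite setDIr setDv set0U.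
  by apply: integral_diff => //; exact: measurableI.
- move=> F tF HF; split.
    by apply: bigcupT_measurable => k; have [] := HF k.
  rewrite setI_bigcupr integral_bigcup//.
  + by apply: eseries0 => k _ _; have [] := HF k.
  + exact: trivIset_setIl.
  + by move=> k; apply: measurableI => //; have [] := HF k.
  + apply: ihS; last by move=> x [k _ []].
    by apply: bigcupT_measurable => k; apply: measurableI => //; have [] := HF k.
Qed.

(** The integral of [h] vanishes on the set where [h] is nonnegative and on its
    complement, so the integral of [|h|] vanishes. *)
Lemma ae0_of_zero_integral :
  \int[mu]_(x in Q `&` [set x | (0 <= h x)%R]) (h x)%:E = 0 ->
  mu.-negligible (Q `&` [set x | h x != 0%R]).
Proof.
set A := Q `&` _ => A0.
have mA : measurable A.
  rewrite (_ : A = Q `&` h @^-1` `[0%R, +oo[%classic).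
    by apply: (mhS (@subset_refl _ _)) => //; exact: measurable_itv.
  by apply/seteqP; split => x [Qx]; rewrite /= in_itv/= andbT.
have AQ : A `<=` Q by move=> x [].
have QA0 := integral_diff mA AQ A0.
have mQA : measurable (Q `\` A) by exact: measurableD.
have habs : \int[mu]_(x in Q) `|(h x)%:E| = 0.
  rewrite -(setDUK AQ) integral_setU//=; first last.
  - by apply/eqP; rewrite setDIK.
  - apply/measurable_EFinP/measurableT_comp => //.
    by apply: mhS; rewrite setDUK.
  have -> : \int[mu]_(x in A) `|h x|%:E = 0.
    rewrite -A0; apply: eq_integral => x /[!inE] -[_ /= hx].
    by rewrite ger0_norm.
  rewrite add0e -[RHS]oppe0 -QA0 -integralN/=; last first.
    by apply: integrable_add_def => //; apply: ihS => // x [].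
  apply: eq_integral => x /[!inE] -[Qx nAx].
  rewrite ltr0_norm// ltNge.
  by apply/negP => hx; apply: nAx; split.
have [N [mN N0 QN]] : ae_eq mu Q (EFin \o h) (cst 0).
  by apply/(ae_eq_integral_abs mu mQ) => //; exact/measurable_EFinP/mhS.
exists N; split=> // x [Qx /eqP hx]; apply: QN => /= /(_ Qx) [].
exact: hx.
Qed.

End zero_integrals.
Section fundamental_lemma.
Local Open Scope ereal_scope.
Context (R : realType) (d : nat) (Omega : set 'rV[R]_d).
Hypothesis openO : open Omega.
Hypothesis bndO : bounded_set Omega.
Local Notation leb := (@lebesgue_outer R d).
Local Notation mu := (@vol R d).

Let mO : leb.-cara.-measurable Omega.
Proof. exact: vol_open_measurable. Qed.

Lemma continuous_sq_integrable (f : 'rV[R]_d -> R) : continuous f ->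
  sq_integrable mu Omega f.
Proof.
move=> cf.
have mf : measurable_fun (Omega : set (caratheodory_type leb)) f.
  by have h := continuous_caratheodory (@lebesgue_halfspace R d) cf mO; exact h.
split => //.
have [p Op] := bounded_sub_box bndO.
have cf2 : continuous (fun x => f x ^+ 2)%R.
  by move=> x; exact: (cvgM (cf x) (cf x)).
have [N [_ fN]] : bounded_set ((fun x => f x ^+ 2)%R @` box p).
  apply: compact_bounded; apply: continuous_compact (compact_box (p := p)).
  exact: continuous_subspaceT.
apply: (measurable_bounded_integrable mO (vol_bounded bndO)).
  exact: measurable_funX.
exists N; split; first exact: num_real.
by move=> M' NM' x Ox; apply: fN => //; exists x => //; exact: Op.
Qed.

Lemma sq_integrable1 : sq_integrable mu Omega (fun=> 1%R).
Proof. by apply: continuous_sq_integrable; exact: cst_continuous. Qed.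

Lemma sq_integrable_integrable h : sq_integrable mu Omega h ->
  mu.-integrable Omega (fun x => (h x)%:E).
Proof.
move=> sh; have := sq_integrableM mO sh sq_integrable1.
by apply: eq_integrable => // x _; rewrite mulr1.
Qed.

Context (h : 'rV[R]_d -> R).
Hypothesis sqh : sq_integrable mu Omega h.
Hypothesis h_orth : forall f, test_function Omega f ->
  (\int[mu]_(x in Omega) (h x * f x) = 0)%R.

Let ih : mu.-integrable Omega (fun x => (h x)%:E).
Proof. exact: sq_integrable_integrable. Qed.

(* Dominated convergence, along test functions tending to the indicator. *)
Let integral_obox_box (p q : 'rV[R]_d * 'rV[R]_d) : box p `<=` Omega ->
  \int[mu]_(x in obox p `&` box q) (h x)%:E = 0.
Proof.
move=> pO; pose S := obox p `&` box q.
have mS : leb.-cara.-measurable S.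
  apply: measurableI; first exact/vol_open_measurable/open_obox.
  exact: box_measurable.
have SO : S `<=` Omega.
  by move=> x [px _]; apply: pO => j; have /andP[/ltW-> /ltW->] := px j.
rewrite -/S -(setIidr SO) integral_mkcondr.
pose f n x := (h x * (inner_bump p n x * outer_bump q n x))%R.
have cf n : continuous (fun x => inner_bump p n x * outer_bump q n x)%R.
  by have [+ _ _] := @test_function_bump _ _ Omega p q n pO => /(_ 0%N) [].
have mf n : measurable_fun (Omega : set (caratheodory_type leb)) (f n).
  apply: measurable_funM; first by case: sqh.
  by have H := continuous_caratheodory (@lebesgue_halfspace R d) (cf n) mO; exact H.
have f0 n : \int[mu]_(x in Omega) (f n x)%:E = 0.
  have := h_orth (@test_function_bump _ _ Omega p q n pO).
  rewrite /Rintegral => /eqP; rewrite -eqe fineK; first by move/eqP.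
  apply: integrable_fin_num => //.
  exact: sq_integrableM sqh (continuous_sq_integrable (cf n)).
have mh : measurable_fun (Omega : set (caratheodory_type leb)) (EFin \o h).
  by case/integrableP : ih.
have mhS : measurable_fun (Omega : set (caratheodory_type leb)) ((EFin \o h) \_ S).
  by apply/measurable_restrict => //; rewrite setIidr//; exact: measurable_funS mh.
have limf x : Omega x -> (f n x)%:E @[n --> \oo] --> ((EFin \o h) \_ S) x.
  move=> Ox; have -> : ((EFin \o h) \_ S) x = (h x * (\1_(obox p) x * \1_(box q) x))%:E.
    rewrite patchE !indicE -natrM mulnb -in_setI -/S.
    by case: (x \in S); rewrite ?mulr1 ?mulr0.
  apply: cvg_EFin; first exact: nearW.
  apply: cvgM; first exact: cvg_cst.
  by apply: cvgM; [exact: cvg_inner_bump|exact: cvg_outer_bump].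
have aelim : {ae mu, forall x, Omega x ->
    (f n x)%:E @[n --> \oo] --> ((EFin \o h) \_ S) x}.
  exact: aeW.
have aedom : {ae mu, forall x n, Omega x -> `|(f n x)%:E| <= `|(h x)%:E|}.
  apply: aeW => x n Ox; rewrite lee_fin normrM ler_piMr//.
  have /andP[s0 s1] := inner_bump_itv p n x.
  have /andP[r0 r1] := outer_bump_itv q n x.
  by rewrite ger0_norm ?mulr_ge0// mulr_ile1.
have mEf n : measurable_fun (Omega : set (caratheodory_type leb)) (fun x => (f n x)%:E).
  exact/measurable_EFinP.
have [_ _] := dominated_convergence mO mEf mhS aelim (integrable_abse ih) aedom.
rewrite (_ : (fun n => _) = fun=> 0); last by apply/funext => n; rewrite f0.
by move/(cvg_unique _ (cvg_cst _)) => <-.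
Qed.

Let obox_sub (p : 'rV[R]_d * 'rV[R]_d) : obox p `<=` box p.
Proof. by move=> x px j; have /andP[/ltW-> /ltW->] := px j. Qed.

(* The integral of [h] over Borel parts of the box is zero by the pi-lambda theorem.
   The set where [h] is nonnegative is only Lebesgue measurable, but replacing it by
   its Borel hull changes no integral. *)
Let ae0_obox (p : 'rV[R]_d * 'rV[R]_d) : box p `<=` Omega ->
  mu.-negligible (obox p `&` [set x | h x != 0%R]).
Proof.
move=> pO.
have mQ : leb.-cara.-measurable (obox p) by exact/vol_open_measurable/open_obox.
have QO : obox p `<=` Omega := subset_trans (@obox_sub p) pO.
have iQ : mu.-integrable (obox p) (fun x => (h x)%:E) by exact: integrableS ih.
have Q0 : \int[mu]_(x in obox p) (h x)%:E = 0.
  by rewrite -(@integral_obox_box p p pO) setIidl//; exact: obox_sub.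
have borel0 : <<s [set B | exists q, B = @box R d q] >> `<=` [set A |
    leb.-cara.-measurable A /\ \int[mu]_(x in obox p `&` A) (h x)%:E = 0].
  apply: lambda_system_subset; [exact: setI_closed_box| | |by []].
    by apply/dynkin_lambda_system; exact: dynkin_zero_integral.
  by move=> _ [q ->]; split; [exact: box_measurable|exact: integral_obox_box].
apply: ae0_of_zero_integral => //.
pose A := obox p `&` [set x | (0 <= h x)%R]; rewrite -/A.
have mhQ : measurable_fun (obox p : set (caratheodory_type leb)) h.
  by apply: measurable_funS sqh.1.
have mA : leb.-cara.-measurable A.
  rewrite (_ : A = obox p `&` h @^-1` `[0%R, +oo[%classic).
    by apply: mhQ => //; exact: measurable_itv.
  by apply/seteqP; split => x [Qx]; rewrite /= in_itv/= andbT.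
have AQ : A `<=` obox p by move=> x [].
have Afin : leb A < +oo.
  apply: le_lt_trans (vol_bounded bndO); apply: le_outer_measure.
  exact: subset_trans QO.
have [D [/borel0[mD QD0] AD D0]] := box_hull mA Afin.
have mQD : leb.-cara.-measurable (obox p `&` D) by exact: measurableI.
rewrite -QD0 (@negligible_integral _ _ _ mu (obox p `&` D) (D `\` A))//; first last.
- by apply: integrableS iQ => // x [].
- exact: measurableD.
have -> // : obox p `&` D `\` (D `\` A) = A.
apply/seteqP; split => [x [[Qx Dx] nDA]|x Ax].
  by apply: contrapT => nAx; apply: nDA.
by split=> [|[_ nAx]]; [split; [exact: AQ|exact: AD]|exact: nAx].
Qed.

(** An open set is a countable union of open boxes whose closures it contains, so
    the result for such boxes is enough. *)
Lemma ae0_of_orthogonal : \forall x \ae mu, Omega x -> h x = 0%R.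
Proof.
pose N (p : 'rV[rat]_d * 'rV[rat]_d) : set 'rV[R]_d :=
  [set x | [/\ box (rat_pair R p) `<=` Omega, obox (rat_pair R p) x & h x != 0%R]].
pose F n := if unpickle n is Some p then N p else set0.
have : mu.-negligible (\bigcup_n F n).
  apply: negligible_bigcup => n; rewrite /F; case: unpickle => [p|].
    have [pO|npO] := pselect (box (rat_pair R p) `<=` Omega).
      by apply: negligibleS (ae0_obox pO) => x [].
    by apply: negligibleS (negligible_set0 _) => x [].
  exact: negligible_set0.
apply: negligibleS => x /= /not_implyP[Ox /eqP hx].
have [p [px pO]] := open_rat_box openO Ox.
by exists (pickle p) => //; rewrite /F pickleK.
Qed.

End fundamental_lemma.
(** * The isotropic elasticity tensor *)

Section elasticity_tensor.
Context (R : realType) (d : nat) (lam mu : R).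
Implicit Types A B : 'M[R]_d.

Lemma actCE A : actC lam mu A = (lam * \tr A)%:M + mu *: (A + A^T).
Proof.
apply/matrixP => i j; rewrite !mxE.
have delta (F : 'I_d -> R) (i0 : 'I_d) : \sum_k (i0 == k)%:R * F k = F i0.
  rewrite (bigD1 i0)//= eqxx mul1r big1 ?addr0// => k ki.
  by rewrite eq_sym (negbTE ki) mul0r.
under eq_bigr => k _.
  rewrite (eq_bigr (fun l => lam * (i == j)%:R * ((k == l)%:R * A k l) +
      mu * ((i == k)%:R * ((j == l)%:R * A k l)) +
      mu * ((j == k)%:R * ((i == l)%:R * A k l)))); last first.
    by move=> l _; rewrite /tensorC; ring.
  rewrite !big_split/= -!mulr_sumr !delta.
  over.
rewrite !big_split/= -!mulr_sumr !delta.
by rewrite -[X in _ = X + _]mulr_natr /mxtrace; ring.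
Qed.

Lemma dotmx_scalar_mx (a : R) B : Defs.dotmx (a%:M) B = a * \tr B.
Proof.
rewrite /Defs.dotmx /mxtrace mulr_sumr; apply: eq_bigr => i _.
rewrite (bigD1 i)//= big1 ?addr0 ?mxE ?eqxx ?mulr1n// => j ji.
by rewrite mxE eq_sym (negbTE ji) mulr0n mul0r.
Qed.

Lemma dotmx_actC A B : Defs.dotmx (actC lam mu A) B =
  lam * \tr A * \tr B + mu * (Defs.dotmx A B + Defs.dotmx A^T B).
Proof.
rewrite actCE [_%:M + _]addrC dotmx_lin dotmx_scalar_mx addrC; congr (_ + mu * _).
by rewrite -[X in X + A^T]scale1r dotmx_lin mul1r.
Qed.

Lemma dotmx_trT A B : Defs.dotmx A^T B^T = Defs.dotmx A B.
Proof.
rewrite /Defs.dotmx exchange_big; apply: eq_bigr => i _; apply: eq_bigr => j _.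
by rewrite !mxE.
Qed.

Lemma dotmx_actC_sym A B :
  Defs.dotmx (actC lam mu A) B = Defs.dotmx (actC lam mu B) A.
Proof.
rewrite !dotmx_actC mulrAC [Defs.dotmx A B]dotmxC; congr (_ + _ * (_ + _)).
by rewrite dotmxC -dotmx_trT trmxK.
Qed.

Lemma actC_lin k A B : actC lam mu (k *: A + B) = k *: actC lam mu A + actC lam mu B.
Proof.
rewrite !actCE; have -> : \tr (k *: A + B) = k * \tr A + \tr B.
  by rewrite linearD/= linearZ.
by apply/matrixP => i j; rewrite !mxE; case: (i == j); rewrite ?mulr1n ?mulr0n; ring.
Qed.

(** Only the symmetric part of a matrix is seen by the tensor, so positivity on
    symmetric matrices gives nonnegativity on all of them. *)
Lemma dotmx_actC_ge0 A : positiveC d lam mu -> 0 <= Defs.dotmx (actC lam mu A) A.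
Proof.
move=> [c c0 posC]; pose S := 2^-1 *: (A + A^T).
have ST : S^T = S by rewrite /S linearZ/= linearD/= trmxK addrC.
have -> : Defs.dotmx (actC lam mu A) A = Defs.dotmx (actC lam mu S) S.
  have trS : \tr S = \tr A.
    by rewrite /S linearZ/= linearD/= mxtrace_tr; field.
  rewrite !dotmx_actC trS ST; congr (_ + _ * _).
  have -> : Defs.dotmx S S = 2^-1 * (Defs.dotmx A A + Defs.dotmx A^T A).
    have E B : Defs.dotmx S B = 2^-1 * (Defs.dotmx A B + Defs.dotmx A^T B).
      rewrite /S /Defs.dotmx -big_split mulr_sumr; apply: eq_bigr => i _.
      rewrite -big_split mulr_sumr; apply: eq_bigr => j _.
      by rewrite !mxE /=; ring.
    rewrite E ![Defs.dotmx _ S]dotmxC !E dotmx_trT [Defs.dotmx A A^T]dotmxC.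
    by field.
  by field.
have S0 : 0 <= c * (\sum_i \sum_j S i j ^+ 2).
  apply: mulr_ge0; first exact: ltW.
  by apply: sumr_ge0 => i _; apply: sumr_ge0 => j _; exact: sqr_ge0.
apply: le_trans S0 _.
apply: le_trans (posC S ST) _; rewrite le_eqVlt; apply/orP; left; apply/eqP.
rewrite /Defs.dotmx; apply: eq_bigr => i _; apply: eq_bigr => j _.
rewrite [actC _ _ _ _ _]mxE mulr_suml; apply: eq_bigr => k _.
by rewrite mulr_suml; apply: eq_bigr => l _; ring.
Qed.

End elasticity_tensor.
(** * Weak gradients and strains *)

Section L2_matrix_maps.
Context (dT : measure_display) (T : measurableType dT) (R : realType).
Context (m : {measure set T -> \bar R}) (D : set T) (d : nat) (lam mu : R).
Hypothesis mD : measurable D.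
Implicit Types f : T -> 'M[R]_d.

Lemma L2_actC f : L2 m D f -> L2 m D (fun x => actC lam mu (f x)).
Proof.
move=> hf i j.
suff : sq_integrable m D (fun x => actC lam mu (f x) i j) by [].
rewrite (_ : (fun x => _) = fun x =>
    \sum_k \sum_l tensorC lam mu i j k l * f x k l).
  apply: sq_integrable_sum => // k; apply: sq_integrable_sum => // l.
  exact: (sq_integrableZ mD _ (hf k l)).
by apply/funext => x; rewrite mxE.
Qed.

Lemma L2_sym_part f : L2 m D f -> L2 m D (fun x => 2^-1 *: (f x + (f x)^T)).
Proof.
move=> hf i j.
suff : sq_integrable m D (fun x => (2^-1 *: (f x + (f x)^T)) i j) by [].
rewrite (_ : (fun x => _) = fun x => 2^-1 * (f x i j + f x j i)).
  exact: (sq_integrableZ mD _ (sq_integrableD mD (hf i j) (hf j i))).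
by apply/funext => x; rewrite !mxE.
Qed.

End L2_matrix_maps.

(** Inference does not see through the Caratheodory type that carries the measure. *)
#[global] Instance ae_vol_filter (R : realType) (d : nat) :
  Filter (nbhs (almost_everywhere (@vol R d))).
Proof. exact: (ae_filter_ringOfSetsType (vol d)). Qed.

Section weak_gradients.
Context (R : realType) (d : nat) (Omega : set 'rV[R]_d).
Hypothesis openO : open Omega.
Hypothesis bndO : bounded_set Omega.
Local Notation leb := (@lebesgue_outer R d).
Local Notation vd := (@vol R d).
Implicit Types (u v : 'rV[R]_d -> 'rV[R]_d) (G H : 'rV[R]_d -> 'M[R]_d).

Let mO : leb.-cara.-measurable Omega.
Proof. exact: vol_open_measurable. Qed.

Let test_sq f : test_function Omega f -> sq_integrable vd Omega f.
Proof.
by move=> [/(_ 0%N)[cf _] _ _]; exact: continuous_sq_integrable.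
Qed.

Let test_partial_sq f j : test_function Omega f ->
  sq_integrable vd Omega (partial j f).
Proof.
move=> [/(_ 1%N)[_ /(_ j)[_ [cf _]]] _ _].
exact: continuous_sq_integrable.
Qed.

Let Rint_lin k (a b c : 'rV[R]_d -> R) : sq_integrable vd Omega a ->
  sq_integrable vd Omega b -> sq_integrable vd Omega c ->
  \int[vd]_(x in Omega) ((k * a x + b x) * c x) =
  k * \int[vd]_(x in Omega) (a x * c x) + \int[vd]_(x in Omega) (b x * c x).
Proof.
move=> sa sb sc; have iac := sq_integrableM mO sa sc.
have ibc := sq_integrableM mO sb sc.
have ikac := sq_integrableM mO (sq_integrableZ mO k sa) sc.
under eq_Rintegral do rewrite mulrDl.
rewrite RintegralD//; congr (_ + _).
by under eq_Rintegral do rewrite -mulrA; rewrite RintegralZl.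
Qed.

Lemma weak_grad_lin k u v G H : L2 vd Omega u -> L2 vd Omega v ->
  is_weak_grad Omega u G -> is_weak_grad Omega v H ->
  is_weak_grad Omega (k *: u + v) (k *: G + H).
Proof.
move=> hu hv [hG uG] [hH vH]; split; first exact: L2_lin.
move=> f tf i j.
under eq_Rintegral do rewrite !mxE.
under [in RHS]eq_Rintegral do rewrite !mxE.
rewrite (Rint_lin k (hu ord0 i) (hv ord0 i) (test_partial_sq j tf)).
rewrite (Rint_lin k (hG i j) (hH i j) (test_sq tf)).
by rewrite uG// vH// mulrN opprD.
Qed.

(** This is what makes [grad], a choice among weak gradients, linear almost
    everywhere. *)
Lemma weak_grad_unique u G H : is_weak_grad Omega u G -> is_weak_grad Omega u H ->
  G = H %[ae vd in Omega].
Proof.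
move=> [hG uG] [hH uH].
have GH i j : \forall x \ae vd, Omega x -> - G x i j + H x i j = 0.
  have sGH : sq_integrable vd Omega (fun x => -1 * G x i j + H x i j).
    exact: (sq_integrableD mO (sq_integrableZ mO (-1) (hG i j)) (hH i j)).
  have /(ae0_of_orthogonal openO bndO sGH) : forall f, test_function Omega f ->
      \int[vd]_(x in Omega) ((-1 * G x i j + H x i j) * f x) = 0.
    move=> f tf; rewrite (Rint_lin (-1) (hG i j) (hH i j) (test_sq tf)).
    by rewrite mulN1r -uG// uH// addrC subrr.
  by apply: filterS => x /[apply]; rewrite mulN1r.
have := @filter_forall _ _ (fun (ij : 'I_d * 'I_d) x =>
  Omega x -> - G x ij.1 ij.2 + H x ij.1 ij.2 = 0) (almost_everywhere vd)
  (ae_filter_ringOfSetsType vd) (fun ij => GH ij.1 ij.2).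
apply: filterS => x GHx Ox; apply/matrixP => i j.
by have /eqP := GHx (i, j) Ox; rewrite addrC subr_eq0 => /eqP.
Qed.

Lemma is_weak_grad_grad u : H1 Omega u -> is_weak_grad Omega u (grad Omega u).
Proof. by move=> [_ uG]; exact: (xgetPex (fun=> 0) uG). Qed.

Lemma H1_lin k u v : H1 Omega u -> H1 Omega v -> H1 Omega (k *: u + v).
Proof.
move=> [hu [G uG]] [hv [H vH]]; split; first exact: L2_lin.
by exists (k *: G + H); exact: weak_grad_lin.
Qed.

Lemma H1_L2 u : H1 Omega u -> L2 vd Omega u. Proof. by case. Qed.

Lemma weak_grad_0 u : (forall x, Omega x -> u x = 0) ->
  is_weak_grad Omega u (0 : 'rV[R]_d -> 'M[R]_d).
Proof.
move=> u0; split=> [|f tf i j]; first exact: L2_zero.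
rewrite (@eq_Rintegral _ _ _ _ _ (fun=> 0)); last first.
  by move=> x /[!inE] /u0 ->; rewrite mxE mul0r.
rewrite [in RHS](@eq_Rintegral _ _ _ _ _ (fun=> 0)); last first.
  by move=> x _; rewrite mxE mul0r.
by rewrite Rintegral_cst// mul0r oppr0.
Qed.

Lemma H1_0 : H1 Omega (0 : 'rV[R]_d -> 'rV[R]_d).
Proof.
split; first exact: L2_zero.
by exists 0; apply: weak_grad_0.
Qed.

Lemma grad_lin k u v : H1 Omega u -> H1 Omega v ->
  grad Omega (k *: u + v) = k *: grad Omega u + grad Omega v %[ae vd in Omega].
Proof.
move=> hu hv; apply: (@weak_grad_unique (k *: u + v)).
  by apply: is_weak_grad_grad; exact: H1_lin.
by apply: weak_grad_lin; [exact: H1_L2|exact: H1_L2|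
  exact: is_weak_grad_grad|exact: is_weak_grad_grad].
Qed.

Lemma symgrad_lin k u v : H1 Omega u -> H1 Omega v ->
  symgrad Omega (k *: u + v) = k *: symgrad Omega u + symgrad Omega v
    %[ae vd in Omega].
Proof.
move=> hu hv; apply: filterS (grad_lin k hu hv) => x /[apply] E.
rewrite /symgrad E [LHS](_ : _ = k *: (2^-1 *: (grad Omega u x + (grad Omega u x)^T))
  + 2^-1 *: (grad Omega v x + (grad Omega v x)^T))//.
apply/matrixP => i j; rewrite !mxE.
move: (grad Omega u x i j) (grad Omega u x j i) => a b.
by move: (grad Omega v x i j) (grad Omega v x j i) => a' b'; ring.
Qed.

Lemma symgrad_eq0 u : H1 Omega u -> (forall x, Omega x -> u x = 0) ->
  symgrad Omega u = (0 : 'rV[R]_d -> 'M[R]_d) %[ae vd in Omega].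
Proof.
move=> hu u0.
have := weak_grad_unique (is_weak_grad_grad hu) (weak_grad_0 u0).
by apply: filterS => x /[apply] E; rewrite /symgrad E trmx0 addr0 scaler0.
Qed.

Lemma L2_symgrad u : H1 Omega u -> L2 vd Omega (symgrad Omega u).
Proof. by move=> /is_weak_grad_grad[hG _]; exact: (L2_sym_part mO hG). Qed.

End weak_gradients.

Section elastic_energy.
Context (R : realType) (d : nat) (Omega : set 'rV[R]_d) (lam mu : R).
Hypothesis openO : open Omega.
Hypothesis bndO : bounded_set Omega.
Hypothesis posC : positiveC d lam mu.
Local Notation leb := (@lebesgue_outer R d).
Local Notation vd := (@vol R d).
Implicit Types (f g h : 'rV[R]_d -> 'M[R]_d) (u v z : 'rV[R]_d -> 'rV[R]_d).

Let mO : leb.-cara.-measurable Omega.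
Proof. exact: vol_open_measurable. Qed.

Lemma ipC_linl k f g h : L2 vd Omega f -> L2 vd Omega g -> L2 vd Omega h ->
  ipC Omega lam mu (k *: f + g) h = k * ipC Omega lam mu f h + ipC Omega lam mu g h.
Proof.
move=> hf hg hh; rewrite /ipC.
rewrite -(ip_linl mO k (L2_actC lam mu mO hf) (L2_actC lam mu mO hg) hh).
by apply: eq_Rintegral => x _; rewrite /= actC_lin.
Qed.

Lemma ipC_comm f g : ipC Omega lam mu f g = ipC Omega lam mu g f.
Proof. by apply: eq_Rintegral => x _; rewrite dotmx_actC_sym. Qed.

Lemma ipC_scalel k f g : L2 vd Omega f -> L2 vd Omega g ->
  ipC Omega lam mu (k *: f) g = k * ipC Omega lam mu f g.
Proof.
move=> hf hg; rewrite /ipC -(ip_scalel mO k (L2_actC lam mu mO hf) hg).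
apply: eq_Rintegral => x _; congr (Defs.dotmx _ _).
have actC0 : actC lam mu (0 : 'M[R]_d) = 0.
  apply/matrixP => i j; rewrite !mxE big1// => k' _.
  by rewrite big1// => l _; rewrite mxE mulr0.
by have := actC_lin lam mu k (f x) 0; rewrite addr0 actC0 addr0.
Qed.

Lemma ipC_linr k f g h : L2 vd Omega f -> L2 vd Omega g -> L2 vd Omega h ->
  ipC Omega lam mu h (k *: f + g) = k * ipC Omega lam mu h f + ipC Omega lam mu h g.
Proof. by move=> hf hg hh; rewrite ipC_comm ipC_linl// ![ipC _ _ _ h _]ipC_comm. Qed.

Lemma ipC_ge0 f : 0 <= ipC Omega lam mu f f.
Proof. by apply: Rintegral_ge0 => x _; exact: dotmx_actC_ge0. Qed.

Lemma normC_sqr f : normC Omega lam mu f ^+ 2 = ipC Omega lam mu f f.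
Proof. by rewrite sqr_sqrtr// ipC_ge0. Qed.

Lemma ipC_ae f f' g g' : L2 vd Omega f -> L2 vd Omega f' -> L2 vd Omega g ->
  L2 vd Omega g' -> f = f' %[ae vd in Omega] -> g = g' %[ae vd in Omega] ->
  ipC Omega lam mu f g = ipC Omega lam mu f' g'.
Proof.
move=> hf hf' hg hg' ff' gg'.
apply: (ip_ae mO (L2_actC lam mu mO hf) (L2_actC lam mu mO hf') hg hg' _ gg').
by apply: filterS ff' => x /[apply] ->.
Qed.

End elastic_energy.
(** * Finite elements *)

Lemma subr_scaleN1 (R : nzRingType) (V : lmodType R) (x y : V) :
  x - y = (-1) *: y + x.
Proof. by rewrite scaleN1r addrC. Qed.

Section finite_dimensional_riesz.
Context (R : realType) (V : lmodType R) (b : V -> V -> R).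

Definition linear_subspace (W : set V) :=
  W 0 /\ forall k u v, W u -> W v -> W (k *: u + v).

Definition linear_on (W : set V) (F : V -> R) :=
  forall k u v, W u -> W v -> F (k *: u + v) = k * F u + F v.

Lemma linear_on0 W F : linear_subspace W -> linear_on W F -> F 0 = 0.
Proof.
move=> [W0 _] lF; have := lF 1 0 0 W0 W0.
by rewrite scaler0 addr0 mul1r => /eqP; rewrite -subr_eq0 opprD addNKr oppr_eq0 => /eqP.
Qed.

(** The equality case of Cauchy-Schwarz for a null vector. *)
Lemma psd_eq0 (W : set V) u v : linear_subspace W ->
  (forall x y, W x -> W y -> b x y = b y x) ->
  (forall y, W y -> linear_on W (b ^~ y)) ->
  (forall x, W x -> 0 <= b x x) ->
  W u -> W v -> b v v = 0 -> b u v = 0.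
Proof.
move=> [W0 WD] bC bl b0 Wu Wv bvv; apply/eqP/negPn/negP => buv.
(* For this [k], [b (k v + u) (k v + u) = 2 k b u v + b u u] is [- 1]. *)
pose k := - (b u u + 1) / (2 * b u v).
have Wkvu : W (k *: v + u) by exact: WD.
have := b0 _ Wkvu.
rewrite bl// ![b _ (k *: v + u)]bC// !bl// bvv mulr0 add0r (bC v u)//.
have -> : k * b u v + (k * b u v + b u u) = - 1.
  by rewrite /k; field.
by rewrite ler0N1.
Qed.

(** The functionals of [s] bound the dimension of [W] modulo the null vectors of
    [b]. By induction on [s]: a Gram-Schmidt step splits off one functional. *)
Lemma riesz_finite (I : eqType) (s : seq I) (L : I -> V -> R) (W : set V)
    (F : V -> R) :
  linear_subspace W ->
  (forall x y, W x -> W y -> b x y = b y x) ->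
  (forall y, W y -> linear_on W (b ^~ y)) ->
  (forall x, W x -> 0 <= b x x) ->
  (forall i, linear_on W (L i)) ->
  (forall v, W v -> (forall i, i \in s -> L i v = 0) -> b v v = 0) ->
  linear_on W F -> (forall v, W v -> b v v = 0 -> F v = 0) ->
  exists2 w, W w & forall v, W v -> b w v = F v.
Proof.
elim: s W F => [|i s IH] W F sW bC bl b0 Ll Ls lF F0; have [W0 WD] := sW.
  exists 0 => // v Wv; have bvv : b v v = 0 by exact: Ls.
  by rewrite F0// -(linear_on0 sW (bl v Wv)).
pose W' := W `&` [set v | L i v = 0].
have sW' : linear_subspace W'.
  split; first by split=> //; exact: (linear_on0 sW (Ll i)).
  move=> k u v [Wu Lu] [Wv Lv]; split; first exact: WD.
  by rewrite /= Ll// Lu Lv mulr0 addr0.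
have IH' G : linear_on W' G -> (forall v, W' v -> b v v = 0 -> G v = 0) ->
    exists2 w, W' w & forall v, W' v -> b w v = G v.
  move=> lG G0; apply: IH => //.
  - by move=> x y [Wx _] [Wy _]; exact: bC.
  - by move=> y [Wy _] k u v [Wu _] [Wv _]; exact: bl.
  - by move=> x [Wx _]; exact: b0.
  - by move=> j k u v [Wu _] [Wv _]; exact: Ll.
  - move=> v [Wv Lv] Lsv; apply: Ls => // j.
    by rewrite inE => /predU1P[->//|]; exact: Lsv.
have lFW' : linear_on W' F by move=> k u v [Wu _] [Wv _]; exact: lF.
have F0W' v : W' v -> b v v = 0 -> F v = 0 by move=> [Wv _]; exact: F0.
have [w' [Ww' Lw'] bw'] := IH' F lFW' F0W'.
have [allL|] := pselect (forall v, W v -> L i v = 0).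
  by exists w' => // v Wv; apply: bw'; split=> //; exact: allL.
move=> /existsNP[v0 /not_implyP[Wv0 /eqP Lv0]].
have br y : W y -> linear_on W (b y).
  by move=> Wy k u v Wu Wv; rewrite bC//; [rewrite bl// ![b _ y]bC|exact: WD].
have [p [Wp Lp] bp] : exists2 p, W' p & forall v, W' v -> b p v = b v0 v.
  apply: IH'; first by move=> k u v [Wu _] [Wv _]; exact: br.
  by move=> v [Wv _]; exact: (psd_eq0 sW bC bl b0).
(* [W] is the [b]-orthogonal sum of [W'] and of the line of [e]. *)
pose e := (-1) *: p + v0.
have We : W e by exact: WD.
have Le : L i e = L i v0 by rewrite Ll// Lp mulr0 add0r.
have be v : W' v -> b e v = 0.
  by move=> W'v; have [Wv _] := W'v; rewrite bl// bp// mulN1r addNr.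
(* If [e] is a null vector then [F e = 0], and any coefficient will do. *)
pose c := if b e e == 0 then 0 else F e / b e e.
have cE : c * b e e = F e.
  rewrite /c; have [bee|bee] := eqVneq (b e e) 0; last by rewrite divfK.
  by rewrite mul0r F0.
exists (c *: e + w'); first exact: WD.
move=> v Wv; pose t := L i v / L i e.
pose v' := (- t) *: e + v.
have Wv' : W v' by exact: WD.
have W'v' : W' v'.
  by split=> //; rewrite /= Ll// /t Le mulNr divfK// addNr.
have -> : v = t *: e + v' by rewrite /v' addrA -scalerDl subrr scale0r add0r.
rewrite lF// br//; last exact: WD.
rewrite ![b (c *: e + w') _]bl// (be v')// mulr0 add0r (bw' v')// cE.
by rewrite (bC w' e)// (be w')// addr0.
Qed.

End finite_dimensional_riesz.

Section finite_element_space.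
Context (R : realType) (d : nat) (Th : seq 'M[R]_(d.+1, d)).
Context (Omega : set 'rV[R]_d).
Implicit Types u v : 'rV[R]_d -> 'rV[R]_d.

Lemma Xh_lin k u v : Xh Th Omega u -> Xh Th Omega v -> Xh Th Omega (k *: u + v).
Proof.
move=> [cu Au] [cv Av]; split.
  move=> x; apply: cvgD; last exact: cv.
  by apply: cvgZr; exact: cu.
move=> P PTh; have [A [a uA]] := Au P PTh; have [B [c vB]] := Av P PTh.
exists (k *: A + B), (k *: a + c) => x Px.
rewrite -[LHS]/(k *: u x + v x) uA// vB// mulmxDr -scalemxAr scalerDr.
by rewrite !addrA; congr (_ + _); rewrite -!addrA; congr (_ + _); rewrite addrC.
Qed.

(** A piecewise affine map is determined by its values at the vertices, finitely
    many linear functionals. *)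
Lemma Xh_vertices_eq0 v : triangulation Th Omega -> Xh Th Omega v ->
  (forall P i, P \in Th -> v (row i P) = 0) -> forall x, Omega x -> v x = 0.
Proof.
move=> [_ _ OmegaE] [_ vaff] v0 x.
rewrite OmegaE => /interior_subset[P /= PTh xP].
have [A [a vE]] := vaff P PTh; have [w [w0 _ w1 xE]] := xP.
have aE i : a = - (row i P *m A).
  have rowP : simplex P (row i P).
    exists (delta_mx ord0 i); split.
    - by move=> j; rewrite mxE ler0n.
    - by move=> j; rewrite inE.
    - rewrite (bigD1 i)//= big1 ?addr0 ?mxE ?eqxx// => j ji.
      by rewrite mxE (negbTE ji) andbF.
    - by rewrite rowE.
  by have /eqP := v0 P i PTh; rewrite vE// addrC addr_eq0 => /eqP.
rewrite vE// xE -mulmxA mulmx_sum_row (eq_bigr (fun i => w ord0 i *: - a)).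
  by rewrite -scaler_suml w1 scale1r addNr.
by move=> i _; rewrite row_mul [in RHS](aE i) opprK.
Qed.

End finite_element_space.
(** * The energy and the reduced energy *)

Section energy_expansion.
Context (R : realType) (d : nat) (Omega : set 'rV[R]_d) (lam mu alpha : R).
Hypothesis openO : open Omega.
Hypothesis bndO : bounded_set Omega.
Hypothesis posC : positiveC d lam mu.
Local Notation leb := (@lebesgue_outer R d).
Local Notation vd := (@vol R d).
Local Notation bC := (ipC Omega lam mu).
Local Notation b2 := (ip vd Omega).
Local Notation eps := (symgrad Omega).
Context (ell : ('rV[R]_d -> 'rV[R]_d) -> R).
Hypothesis ell_lin : linear_on (H1 Omega) ell.
Local Notation E := (energy Omega lam mu alpha ell).
Implicit Types (phi psi : 'rV[R]_d -> 'M[R]_d) (v z : 'rV[R]_d -> 'rV[R]_d).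

Let mO : leb.-cara.-measurable Omega.
Proof. exact: vol_open_measurable. Qed.

Lemma strain_lin t z v psi phi : H1 Omega z -> H1 Omega v ->
  eps (t *: z + v) - (t *: psi + phi) = t *: (eps z - psi) + (eps v - phi)
    %[ae vd in Omega].
Proof.
move=> hz hv; apply: filterS (symgrad_lin openO bndO t hz hv) => x /[apply] Ex.
rewrite -[LHS]/(eps (t *: z + v) x - (t *: psi x + phi x)) Ex.
rewrite -[RHS]/(t *: (eps z x - psi x) + (eps v x - phi x)).
by rewrite -[X in X - _]/(t *: eps z x + eps v x) scalerBr opprD addrACA.
Qed.

Lemma energyE v phi : E v phi =
  2^-1 * bC (eps v - phi) (eps v - phi) + alpha / 2 * b2 phi phi - ell v.
Proof. by rewrite /energy normC_sqr// norm2_sqr. Qed.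

Lemma L2_strain v phi : H1 Omega v -> L2 vd Omega phi ->
  L2 vd Omega (eps v - phi).
Proof. by move=> hv hphi; exact: (L2B mO (L2_symgrad openO hv) hphi). Qed.

Lemma energy_expand t z v psi phi : H1 Omega z -> H1 Omega v ->
  L2 vd Omega psi -> L2 vd Omega phi ->
  E (t *: z + v) (t *: psi + phi) = E v phi
    + t * (bC (eps v - phi) (eps z - psi) + alpha * b2 phi psi - ell z)
    + t ^+ 2 * (2^-1 * bC (eps z - psi) (eps z - psi) + alpha / 2 * b2 psi psi).
Proof.
move=> hz hv hpsi hphi.
have hs := L2_strain hz hpsi; have hs0 := L2_strain hv hphi.
have hts := L2_lin mO t hs hs0.
have htp := L2_lin mO t hpsi hphi.
have hL := L2_strain (H1_lin openO bndO t hz hv) htp.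
have sl := strain_lin t psi phi hz hv.
rewrite !energyE ell_lin// (ipC_ae lam mu openO hL hts hL hts sl sl).
rewrite (ipC_linl lam mu openO t hs hs0 hts) (ipC_linr lam mu openO t hs hs0 hs).
rewrite (ipC_linr lam mu openO t hs hs0 hs0).
rewrite (ip_linl mO t hpsi hphi htp) (ip_linr mO t hpsi hphi hpsi).
rewrite (ip_linr mO t hpsi hphi hphi).
rewrite [bC (eps z - psi) (eps v - phi)]ipC_comm [b2 psi phi]ip_sym.
by field.
Qed.

End energy_expansion.
Section quadratic_functions.
Context (R : realType).

Lemma min_onE (T : Type) (A : set T) (F : T -> R) v0 : A v0 ->
  (forall v, A v -> F v0 <= F v) -> min_on A F = F v0.
Proof.
move=> Av0 Fmin; apply: xget_unique => [|m [[v Av <-] mle]].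
  by split=> //; exists v0.
by apply/eqP; rewrite eq_le Fmin// mle.
Qed.

Lemma is_derive_quadratic (a b c : R) :
  is_derive (0 : R) 1 (fun t : R => a + t * b + t ^+ 2 * c) b.
Proof.
pose p : {poly R} := a%:P + b *: 'X + c *: 'X^2.
have -> : (fun t : R => a + t * b + t ^+ 2 * c) = horner p.
  by apply/funext => t; rewrite !hornerE /=; ring.
apply: DeriveDef; first exact: derivable_horner.
rewrite -derive1E -derivE /p !derivD derivC !derivZ derivX derivXn.
by rewrite !hornerE /=; ring.
Qed.

End quadratic_functions.

Section reduced_energy.
Context (R : realType) (d : nat) (Omega : set 'rV[R]_d) (lam mu alpha : R).
Hypothesis openO : open Omega.
Hypothesis bndO : bounded_set Omega.
Hypothesis posC : positiveC d lam mu.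
Local Notation leb := (@lebesgue_outer R d).
Local Notation vd := (@vol R d).
Local Notation bC := (ipC Omega lam mu).
Local Notation b2 := (ip vd Omega).
Local Notation eps := (symgrad Omega).
Context (ell : ('rV[R]_d -> 'rV[R]_d) -> R).
Hypothesis ell_lin : linear_on (H1 Omega) ell.
Local Notation E := (energy Omega lam mu alpha ell).
Implicit Types (phi psi : 'rV[R]_d -> 'M[R]_d) (v z w : 'rV[R]_d -> 'rV[R]_d).

Let mO : leb.-cara.-measurable Omega.
Proof. exact: vol_open_measurable. Qed.

(** [W] and [A] are the discrete spaces with homogeneous and with prescribed
    boundary values. *)
Context (W A : set ('rV[R]_d -> 'rV[R]_d)).
Hypothesis sW : linear_subspace W.
Hypothesis WH1 : W `<=` H1 Omega.
Hypothesis AH1 : A `<=` H1 Omega.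
Hypothesis A_sub : forall u v, A u -> A v -> W (u - v).
Hypothesis A_add : forall t z v, W z -> A v -> A (t *: z + v).

Let subspace_L2 : linear_subspace (@L2 _ _ _ vd Omega d d).
Proof. by split=> [|k u v hu hv]; [exact: L2_zero|exact: (L2_lin mO k hu hv)]. Qed.

Let bC_lin y : L2 vd Omega y -> linear_on (@L2 _ _ _ vd Omega d d) (bC ^~ y).
Proof. by move=> hy k u v hu hv; exact: (ipC_linl lam mu openO k hu hv hy). Qed.

Let ip0 phi : L2 vd Omega phi -> b2 phi 0 = 0.
Proof. by move=> hphi; rewrite ip_sym; exact: (ip0l mO hphi). Qed.

Lemma equilibrium_min v0 phi : A v0 -> L2 vd Omega phi ->
  (forall v, W v -> bC (eps v0 - phi) (eps v) = ell v) ->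
  forall v, A v -> E v0 phi <= E v phi.
Proof.
move=> Av0 hphi eqv v Av; pose z := v - v0.
have Wz : W z by exact: A_sub.
have := energy_expand alpha openO bndO posC ell_lin 1 (WH1 Wz) (AH1 Av0)
  (@L2_zero _ _ R vd Omega d d) hphi.
rewrite !scale1r add0r subrK !subr0 => ->.
rewrite eqv// (ip0 hphi) (ip0 (@L2_zero _ _ R vd Omega d d)) !mulr0 !addr0 subrr.
by rewrite mulr0 addr0 lerDl expr1n mul1r mulr_ge0// ipC_ge0.
Qed.

Context (I : eqType) (s : seq I) (L : I -> ('rV[R]_d -> 'rV[R]_d) -> R).
Hypothesis L_lin : forall i, linear_on W (L i).
Hypothesis L_eq0 : forall v, W v -> (forall i, i \in s -> L i v = 0) ->
  forall x, Omega x -> v x = 0.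

(** The functionals [L] serve to bound the dimension of [W]. *)
Lemma strain_projection psi : L2 vd Omega psi ->
  exists2 w, W w & forall v, W v -> bC (eps w) (eps v) = bC psi (eps v).
Proof.
move=> hpsi.
have hE v : W v -> L2 vd Omega (eps v).
  by move=> Wv; exact: (L2_symgrad openO (WH1 Wv)).
have eps_lin k u v y : W u -> W v -> L2 vd Omega y ->
    bC (eps (k *: u + v)) y = k * bC (eps u) y + bC (eps v) y.
  move=> Wu Wv hy; rewrite -(ipC_linl lam mu openO k (hE _ Wu) (hE _ Wv) hy).
  apply: (ipC_ae lam mu openO _ (L2_lin mO k (hE _ Wu) (hE _ Wv)) hy hy).
  - by apply: hE; exact: sW.2.
  - exact: (symgrad_lin openO bndO k (WH1 Wu) (WH1 Wv)).
  - exact: aeW.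
apply: (@riesz_finite _ _ (fun u v => bC (eps u) (eps v)) _ s L W _ sW).
- by move=> x y _ _; exact: ipC_comm.
- by move=> y Wy k u v Wu Wv; exact: (eps_lin _ _ _ _ Wu Wv (hE _ Wy)).
- by move=> x _; exact: (ipC_ge0 Omega posC).
- exact: L_lin.
- move=> v Wv Lv; have v0 := symgrad_eq0 openO bndO (WH1 Wv) (L_eq0 Wv Lv).
  have h0 := @L2_zero _ _ R vd Omega d d.
  rewrite (ipC_ae lam mu openO (hE _ Wv) h0 (hE _ Wv) h0 v0 v0).
  exact: (linear_on0 subspace_L2 (bC_lin h0)).
- move=> k u v Wu Wv; rewrite ![bC psi _]ipC_comm.
  exact: (eps_lin _ _ _ _ Wu Wv hpsi).
- move=> v Wv; apply: (psd_eq0 subspace_L2 _ bC_lin _ hpsi (hE _ Wv)).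
  + by move=> x y _ _; exact: ipC_comm.
  + by move=> x _; exact: (ipC_ge0 Omega posC).
Qed.

(** Along a line, a minimiser depends affinely on the parameter, so the reduced
    energy is a quadratic polynomial; the derivative of the minimiser drops out by
    equilibrium. *)
Lemma reduced_energy_derive v0 phi psi : A v0 ->
  L2 vd Omega phi -> L2 vd Omega psi ->
  (forall v, W v -> bC (eps v0 - phi) (eps v) = ell v) ->
  is_derive (0 : R) 1 (fun t : R => min_on A (fun v => E v (phi + t *: psi)))
    (alpha * b2 phi psi - bC (eps v0 - phi) psi).
Proof.
move=> Av0 hphi hpsi eqv.
have [w Ww wE] := strain_projection hpsi.
have hw := WH1 Ww; have hv0 := AH1 Av0.
have hs0 := L2_strain openO hv0 hphi; have hsw := L2_strain openO hw hpsi.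
have hew := L2_symgrad openO hw.
have equil t v : W v -> bC (eps (t *: w + v0) - (t *: psi + phi)) (eps v) = ell v.
  move=> Wv; have hv := L2_symgrad openO (WH1 Wv).
  have hL := L2_strain openO (H1_lin openO bndO t hw hv0) (L2_lin mO t hpsi hphi).
  rewrite (ipC_ae lam mu openO hL (L2_lin mO t hsw hs0) hv hv
    (strain_lin openO bndO t psi phi hw hv0) (aeW _ (fun _ _ => erefl))).
  rewrite (ipC_linl lam mu openO t hsw hs0 hv) eqv//.
  have -> : eps w - psi = (-1) *: psi + eps w by exact: subr_scaleN1.
  rewrite (ipC_linl lam mu openO (-1) hpsi hew hv) wE// mulN1r addNr mulr0.
  by rewrite add0r.
have dE : bC (eps v0 - phi) (eps w - psi) + alpha * b2 phi psi - ell w =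
    alpha * b2 phi psi - bC (eps v0 - phi) psi.
  have -> : eps w - psi = (-1) *: psi + eps w by exact: subr_scaleN1.
  rewrite (ipC_linr lam mu openO (-1) hpsi hew hs0) eqv// mulN1r.
  by rewrite addrAC addrK addrC.
rewrite -dE.
rewrite (_ : (fun t => _) = fun t : R => E v0 phi
    + t * (bC (eps v0 - phi) (eps w - psi) + alpha * b2 phi psi - ell w)
    + t ^+ 2 * (2^-1 * bC (eps w - psi) (eps w - psi) + alpha / 2 * b2 psi psi)).
  exact: is_derive_quadratic.
apply/funext => t.
rewrite -(energy_expand alpha openO bndO posC ell_lin t hw hv0 hpsi hphi).
rewrite [phi + _]addrC; apply: min_onE; first exact: A_add.
apply: equilibrium_min; first exact: A_add.
  exact: L2_lin.
exact: equil.
Qed.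

End reduced_energy.
(** * Traces, loads and discrete spaces *)

Section L2_restriction.
Context (dT : measure_display) (T : measurableType dT) (R : realType).
Context (m : {measure set T -> \bar R}).

Lemma L2_subset (D D' : set T) (p q : nat) (f : T -> 'M[R]_(p, q)) :
  measurable D -> measurable D' -> D' `<=` D -> L2 m D f -> L2 m D' f.
Proof.
move=> mD mD' sub hf i j; have [mf sqf] := hf i j; split.
  exact: measurable_funS mf.
exact: integrableS sqf.
Qed.

End L2_restriction.

#[global] Instance ae_surf_filter (R : realType) (d : nat) :
  Filter (nbhs (almost_everywhere (@surf R d))).
Proof. exact: (ae_filter_ringOfSetsType (surf d)). Qed.

Section traces.
Context (R : realType) (d : nat) (Omega : set 'rV[R]_d).
Hypothesis openO : open Omega.
Hypothesis bndO : bounded_set Omega.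
Context (gam : ('rV[R]_d -> 'rV[R]_d) -> 'rV[R]_d -> 'rV[R]_d).
Hypothesis hgam : is_trace Omega gam.
Local Notation haus := (@hausdorff_outer R d d.-1).
Local Notation vd := (@vol R d).
Local Notation sd := (@surf R d).
Implicit Types (f q u v : 'rV[R]_d -> 'rV[R]_d).

Let mO : (@lebesgue_outer R d).-cara.-measurable Omega.
Proof. exact: vol_open_measurable. Qed.

Lemma surf_closed_measurable (F : set 'rV[R]_d) : closed F ->
  haus.-cara.-measurable F.
Proof.
move=> cF; have h := closed_caratheodory (@hausdorff_halfspace R d d.-1) cF.
exact h.
Qed.

Lemma surf_boundary_measurable : haus.-cara.-measurable (boundary Omega).
Proof.
apply: surf_closed_measurable; rewrite /boundary setDE.
apply: closedI; first exact: closed_closure.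
by apply: open_closedC; exact: open_interior.
Qed.

Lemma surf_neumann_measurable (G : set 'rV[R]_d) :
  haus.-cara.-measurable (boundary Omega `\` closure G).
Proof.
apply: measurableD; first exact: surf_boundary_measurable.
exact/surf_closed_measurable/closed_closure.
Qed.

Lemma trace_lin k u v : H1 Omega u -> H1 Omega v ->
  gam (k *: u + v) = k *: gam u + gam v %[ae sd in boundary Omega].
Proof. by have [+ _ _] := hgam; apply. Qed.

Lemma trace_lin_sub (D : set 'rV[R]_d) k u v : D `<=` boundary Omega ->
  H1 Omega u -> H1 Omega v ->
  gam (k *: u + v) = k *: gam u + gam v %[ae sd in D].
Proof.
by move=> sub hu hv; apply: filterS (trace_lin k hu hv) => x h /sub; exact: h.
Qed.

Lemma trace0 : gam 0 = 0 %[ae sd in boundary Omega].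
Proof.
have h0 := H1_0 openO.
apply: filterS (trace_lin 1 h0 h0) => x /[apply]; rewrite scaler0 addr0.
rewrite -[RHS]/(1 *: gam 0 x + gam 0 x) scale1r => /eqP.
by rewrite -subr_eq0 opprD addNKr oppr_eq0 => /eqP.
Qed.

Lemma L2_trace u : H1 Omega u -> L2 sd (boundary Omega) (gam u).
Proof. by have [_ [c hc] _] := hgam; move=> /hc[]. Qed.

Lemma load_lin (G : set 'rV[R]_d) f q :
  L2 vd Omega f -> L2 sd (boundary Omega `\` closure G) q ->
  linear_on (H1 Omega) (load Omega (boundary Omega `\` closure G) gam f q).
Proof.
move=> hf hq k u v hu hv; rewrite /load.
have mG := surf_neumann_measurable G; have mB := surf_boundary_measurable.
have sub : boundary Omega `\` closure G `<=` boundary Omega by exact: subDsetl.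
have hg w : H1 Omega w -> L2 sd (boundary Omega `\` closure G) (gam w).
  by move=> /L2_trace; exact: L2_subset mB mG sub.
rewrite (ip_linr mO k (H1_L2 hu) (H1_L2 hv) hf).
rewrite (ip_ae mG hq hq (hg _ (H1_lin openO bndO k hu hv))
  (L2_lin mG k (hg _ hu) (hg _ hv)) (aeW _ (fun _ _ => erefl))
  (trace_lin_sub k sub hu hv)).
rewrite (ip_linr mG k (hg _ hu) (hg _ hv) hq).
by rewrite mulrDr addrACA.
Qed.

Lemma load_ae (G : set 'rV[R]_d) f f' q q' v : H1 Omega v ->
  L2 vd Omega f -> L2 vd Omega f' ->
  L2 sd (boundary Omega `\` closure G) q ->
  L2 sd (boundary Omega `\` closure G) q' ->
  f = f' %[ae vd in Omega] -> q = q' %[ae sd in boundary Omega `\` closure G] ->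
  load Omega (boundary Omega `\` closure G) gam f q v =
  load Omega (boundary Omega `\` closure G) gam f' q' v.
Proof.
move=> hv hf hf' hq hq' ff' qq'.
have mG := surf_neumann_measurable G; have mB := surf_boundary_measurable.
have hgv : L2 sd (boundary Omega `\` closure G) (gam v).
  exact: L2_subset mB mG (@subDsetl _ _ _) (L2_trace hv).
congr (_ + _).
  exact: (ip_ae mO hf hf' (H1_L2 hv) (H1_L2 hv) ff' (aeW _ (fun _ _ => erefl))).
exact: (ip_ae mG hq hq' hgv hgv qq' (aeW _ (fun _ _ => erefl))).
Qed.

Section discrete_spaces.
Context (Th : seq 'M[R]_(d.+1, d)) (Gamma0 : set 'rV[R]_d).
Hypothesis Gamma0_sub : Gamma0 `<=` boundary Omega.
Local Notation V := (Vh Th Omega gam Gamma0).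

Let trace00 : gam 0 = 0 %[ae sd in Gamma0].
Proof. by apply: filterS trace0 => x h /Gamma0_sub; exact: h. Qed.

Lemma Vh_H1 g v : V g v -> H1 Omega v. Proof. by case=> _ []. Qed.

Lemma Vh_add g k z v : V 0 z -> V g v -> V g (k *: z + v).
Proof.
move=> [Xz [hz gz]] [Xv [hv gv]]; split; first exact: Xh_lin.
split; first exact: (H1_lin openO bndO k hz hv).
have tl := trace_lin_sub k Gamma0_sub hz hv.
apply: filterS (filterI (filterI tl trace00) (filterI gz gv)).
move=> x [[tx t0] [gzx gvx]] Gx.
rewrite (tx Gx) -[LHS]/(k *: gam z x + gam v x) (gzx Gx) (t0 Gx) (gvx Gx).
by rewrite -[0 x]/(0 : 'rV[R]_d) scaler0 add0r.
Qed.

Lemma Vh_sub g u v : V g u -> V g v -> V 0 (u - v).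
Proof.
move=> [Xu [hu gu]] [Xv [hv gv]].
have -> : u - v = (-1) *: v + u by exact: subr_scaleN1.
split; first exact: Xh_lin.
split; first exact: (H1_lin openO bndO (-1) hv hu).
have tl := trace_lin_sub (-1) Gamma0_sub hv hu.
apply: filterS (filterI (filterI tl trace00) (filterI gu gv)).
move=> x [[tx t0] [gux gvx]] Gx.
rewrite (tx Gx) (t0 Gx) -[LHS]/((-1) *: gam v x + gam u x) (gux Gx) (gvx Gx).
by rewrite scaleN1r addNr.
Qed.

Lemma Vh_subspace : linear_subspace (V 0).
Proof.
split=> [|k u v Vu Vv]; last exact: Vh_add.
split; last by split; [exact: (H1_0 openO)|exact: aeW].
split; first by move=> x; exact: cst_continuous.
by move=> P _; exists 0, 0 => x _; rewrite mulmx0 addr0.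
Qed.

End discrete_spaces.
End traces.
(** * One step of the scheme *)

Section implicit_step.
Context (R : realType) (d : nat) (Omega : set 'rV[R]_d) (lam mu alpha eta tau : R).
Hypothesis openO : open Omega.
Hypothesis bndO : bounded_set Omega.
Hypothesis posC : positiveC d lam mu.
Hypothesis tau_gt0 : 0 < tau.
Local Notation leb := (@lebesgue_outer R d).
Local Notation vd := (@vol R d).
Local Notation bC := (ipC Omega lam mu).
Local Notation b2 := (ip vd Omega).
Local Notation eps := (symgrad Omega).
Context (ell : ('rV[R]_d -> 'rV[R]_d) -> R).
Hypothesis ell_lin : linear_on (H1 Omega) ell.
Local Notation E := (energy Omega lam mu alpha ell).

Let mO : leb.-cara.-measurable Omega.
Proof. exact: vol_open_measurable. Qed.

Context (u u' : 'rV[R]_d -> 'rV[R]_d) (phi phi' : 'rV[R]_d -> 'M[R]_d).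
Hypotheses (hu : H1 Omega u) (hu' : H1 Omega u').
Hypotheses (hphi : L2 vd Omega phi) (hphi' : L2 vd Omega phi').
Let D := tau^-1 *: (phi - phi').
Hypothesis evol : eta *: D + alpha *: phi - sigma Omega lam mu u phi
  = (fun=> 0) %[ae vd in Omega].

Let L2D : L2 vd Omega D.
Proof. exact: (L2Z mO _ (L2B mO hphi hphi')). Qed.

Lemma evolution_weak psi : L2 vd Omega psi ->
  b2 (eta *: D) psi = bC (eps u - phi) psi - alpha * b2 phi psi.
Proof.
move=> hpsi; have hs := L2_strain openO hu hphi.
have hsig := L2_actC lam mu mO hs.
have L2eta := L2Z mO eta L2D.
have Lr := L2_lin mO (- alpha) hphi hsig.
have ev : eta *: D = (- alpha) *: phi + (fun x => actC lam mu ((eps u - phi) x))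
    %[ae vd in Omega].
  apply: filterS evol => x /[apply].
  rewrite -[LHS]/((eta *: D) x + alpha *: phi x - sigma Omega lam mu u phi x).
  rewrite -[RHS in _ -> _ = RHS]/((- alpha) *: phi x + sigma Omega lam mu u phi x).
  move=> /eqP; rewrite subr_eq0 => /eqP <-.
  by rewrite scaleNr [_ + alpha *: _]addrC addrA addNr add0r.
rewrite (ip_ae mO L2eta Lr hpsi hpsi ev (aeW _ (fun _ _ => erefl))).
by rewrite (ip_linl mO (- alpha) hphi hsig hpsi) mulNr addrC.
Qed.

Hypothesis equil : bC (eps u - phi) (eps (u' - u)) = ell (u' - u).

(** Expanding the old energy around the new state, the linear term is the work of
    the driving force, and the quadratic term the numerical dissipation. *)
Lemma energy_step :
  tau^-1 * (E u phi - E u' phi') + alpha * tau / 2 * b2 D D +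
  tau / 2 * bC (tau^-1 *: ((eps u - phi) - (eps u' - phi')))
               (tau^-1 *: ((eps u - phi) - (eps u' - phi'))) = - eta * b2 D D.
Proof.
have tau0 : tau != 0 by rewrite gt_eqF.
set a := tau^-1 *: (_ - _).
have hs := L2_strain openO hu hphi; have hs' := L2_strain openO hu' hphi'.
have ha : L2 vd Omega a by exact: (L2Z mO _ (L2B mO hs hs')).
have zE : u' - u = (-1) *: u + u' by exact: subr_scaleN1.
have hz : H1 Omega (u' - u) by rewrite zE; exact: (H1_lin openO bndO (-1) hu hu').
have psiE : phi' - phi = (- tau) *: D.
  by rewrite /D scalerA mulNr divff// scaleN1r opprB.
have hpsi : L2 vd Omega (phi' - phi) by exact: (L2B mO hphi' hphi).
have hsz := L2_strain openO hz hpsi.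
have hta : L2 vd Omega ((- tau) *: a) by exact: (L2Z mO _ ha).
have aE : eps (u' - u) - (phi' - phi) = (- tau) *: a %[ae vd in Omega].
  have mxE' (A A' B B' : 'M[R]_d) : (-1) *: A + A' - (B' - B) =
      (- tau) *: (tau^-1 *: ((A - B) - (A' - B'))).
    rewrite scalerA mulNr divff// !scaleN1r !opprB.
    by rewrite [- A + A']addrC addrACA [RHS]addrACA [- B' - A]addrC.
  rewrite zE; apply: filterS (symgrad_lin openO bndO (-1) hu hu') => x /[apply] Ex.
  rewrite -[LHS]/(eps (-1 *: u + u') x - (phi' x - phi x)) Ex.
  exact: mxE'.
have Eold := energy_expand alpha openO bndO posC ell_lin 1 hz hu hpsi hphi.
rewrite !scale1r !subrK in Eold.
have e1 : bC (eps u - phi) (eps (u' - u) - (phi' - phi)) =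
    ell (u' - u) + tau * bC (eps u - phi) D.
  have -> : eps (u' - u) - (phi' - phi) = tau *: D + eps (u' - u).
    by rewrite psiE subr_scaleN1 scalerA mulN1r opprK.
  by rewrite (ipC_linr lam mu openO tau L2D (L2_symgrad openO hz) hs) equil addrC.
have htD : L2 vd Omega ((- tau) *: D) by rewrite -psiE.
have e2 : b2 phi (phi' - phi) = - tau * b2 phi D.
  by rewrite psiE ip_sym (ip_scalel mO (- tau) L2D hphi) ip_sym.
have e3 : b2 (phi' - phi) (phi' - phi) = tau ^+ 2 * b2 D D.
  rewrite psiE (ip_scalel mO (- tau) L2D htD) ip_sym.
  by rewrite (ip_scalel mO (- tau) L2D L2D); ring.
have e4 : bC (eps (u' - u) - (phi' - phi)) (eps (u' - u) - (phi' - phi)) =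
    tau ^+ 2 * bC a a.
  rewrite (ipC_ae lam mu openO hsz hta hsz hta aE aE).
  rewrite (ipC_scalel lam mu openO (- tau) ha hta) ipC_comm.
  by rewrite (ipC_scalel lam mu openO (- tau) ha ha); ring.
have e5 : bC (eps u - phi) D = eta * b2 D D + alpha * b2 phi D.
  have := evolution_weak L2D; rewrite (ip_scalel mO eta L2D L2D) => ->.
  by rewrite subrK.
rewrite Eold e1 e2 e3 e4 e5.
move: (bC a a) (b2 D D) (b2 phi D) (ell (u' - u)) (E u phi) => x y z l e.
by field.
Qed.

End implicit_step.
Theorem theorem5p5 (R : realType) (d : nat) (hd : d = 2%N \/ d = 3%N)
  (T : R) (hT : 0 < T)
  (Omega : set 'rV[R]_d) (hOmega : lipschitz_domain Omega)
  (Gamma0 : set 'rV[R]_d)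
  (hGamma0_open : exists2 U, open U & Gamma0 = U `&` boundary Omega)
  (hGamma0_pos : (0 < surf d Gamma0)%E)
  (hGamma0_closure : surf d (closure Gamma0) = surf d Gamma0)
  (eta : R) (heta : 0 < eta) (alpha : R) (halpha : 0 <= alpha)
  (lam mu : R) (hC : @positiveC R d lam mu)
  (gam : ('rV[R]_d -> 'rV[R]_d) -> 'rV[R]_d -> 'rV[R]_d)
  (hgam : is_trace Omega gam)
  (f g q : R -> 'rV[R]_d -> 'rV[R]_d) (phi0 : 'rV[R]_d -> 'M[R]_d)
  (hf : cont_L2 (vol d) Omega T f)
  (hg : cont_H1 Omega T g)
  (hq : cont_L2 (surf d) (boundary Omega `\` closure Gamma0) T q)
  (hphi0 : L2sym Omega phi0)
  (hf_indep : time_independent (vol d) Omega T f)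
  (hg_indep : time_independent (vol d) Omega T g)
  (hq_indep :
    time_independent (surf d) (boundary Omega `\` closure Gamma0) T q)
  (Th : seq 'M[R]_(d.+1, d)) (hTh : triangulation Th Omega)
  (tau : R) (htau : 0 < tau)
  (gh : 'rV[R]_d -> 'rV[R]_d) (hgh : Xh Th Omega gh)
  (phih0 : 'rV[R]_d -> 'M[R]_d) (hphih0 : Psih Th Omega phih0)
  (u : nat -> 'rV[R]_d -> 'rV[R]_d) (phi : nat -> 'rV[R]_d -> 'M[R]_d) :
  let Gamma1 := boundary Omega `\` closure Gamma0 in
  let NT := Num.truncn (T / tau) in
  let t := fun k : nat => k%:R * tau in
  let ell := fun k : nat => load Omega Gamma1 gam (f (t k)) (q (t k)) in
  let E := fun k : nat => energy Omega lam mu alpha (ell k) in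
  let Estar := fun (k : nat) (psi : 'rV[R]_d -> 'M[R]_d) =>
    min_on [set v | Vh Th Omega gam Gamma0 gh v] (fun v => E k v psi) in
  forall
  (hspaces : forall k, (k <= NT)%N ->
     Vh Th Omega gam Gamma0 gh (u k) /\ Psih Th Omega (phi k))
  (hinit : phi 0%N = phih0 %[ae vol d in Omega])
  (hequilibrium : forall k, (k <= NT)%N ->
     forall v, Vh Th Omega gam Gamma0 (fun=> 0) v ->
       ip (vol d) Omega (sigma Omega lam mu (u k) (phi k)) (symgrad Omega v)
       = ell k v)
  (hevolution : forall k, (0 < k <= NT)%N ->
     eta *: Dtau tau phi k + alpha *: phi k - sigma Omega lam mu (u k) (phi k)
     = (fun=> 0) %[ae vol d in Omega]),
  forall k, (0 < k <= NT)%N ->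
    (forall psi, Psih Th Omega psi ->
       gateaux_derivable (Estar k) (phi k) psi /\
       ip (vol d) Omega (eta *: Dtau tau phi k) psi
       = - gateaux (Estar k) (phi k) psi)
    /\
    (Dtau tau (fun k => E k (u k) (phi k) : R^o) k
       + alpha * tau / 2 * norm2 (vol d) Omega (Dtau tau phi k) ^+ 2
       + tau / 2 *
         normC Omega lam mu
           (Dtau tau (fun k => symgrad Omega (u k) - phi k) k) ^+ 2
       = - eta * norm2 (vol d) Omega (Dtau tau phi k) ^+ 2
     /\ - eta * norm2 (vol d) Omega (Dtau tau phi k) ^+ 2 <= 0).
Proof.
move=> Gamma1 NT t ell E Estar hspaces hinit hequilibrium hevolution k /andP[k0 kNT].
have [_ openO _ bndO _] := hOmega.
have mO : (@lebesgue_outer R d).-cara.-measurable Omega by exact: vol_open_measurable.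
have Gamma0_sub : Gamma0 `<=` boundary Omega.
  by have [U _ ->] := hGamma0_open; exact: subIsetr.
have t_itv j : (j <= NT)%N -> t j \in `[0, T].
  move=> jNT; rewrite in_itv /= /t mulr_ge0 ?(ltW htau)//=.
  rewrite -ler_pdivlMr//; apply: le_trans (_ : NT%:R <= _); first by rewrite ler_nat.
  by rewrite /NT truncn_le ?divr_ge0// ltW.
have hfk j : (j <= NT)%N -> L2 (vol d) Omega (f (t j)).
  by move=> /t_itv /hf[].
have hqk j : (j <= NT)%N -> L2 (surf d) Gamma1 (q (t j)).
  by move=> /t_itv /hq[].
have ell_lin : linear_on (H1 Omega) (ell k).
  exact: (load_lin openO bndO hgam (hfk k kNT) (hqk k kNT)).
have k1NT : (k.-1 <= NT)%N by exact: leq_trans (leq_pred k) kNT.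
have ellE v : H1 Omega v -> ell k.-1 v = ell k v.
  move=> hv; apply: (load_ae openO hgam hv (hfk _ k1NT) (hfk _ kNT)
    (hqk _ k1NT) (hqk _ kNT)).
  - exact: hf_indep (t_itv _ k1NT) (t_itv _ kNT).
  - exact: hq_indep (t_itv _ k1NT) (t_itv _ kNT).
have [Vu [[hphi _] _]] := hspaces k kNT.
have [Vu' [[hphi' _] _]] := hspaces k.-1 k1NT.
have hu := Vh_H1 Vu; have hu' := Vh_H1 Vu'.
have equil v : Vh Th Omega gam Gamma0 0 v ->
    ipC Omega lam mu (symgrad Omega (u k) - phi k) (symgrad Omega v) = ell k v.
  exact: hequilibrium.
have evol := hevolution k (introT andP (conj k0 kNT)).
split.
- move=> psi [[hpsi _] _].
  pose vertices := [seq (P, ij) | P <- Th,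
    ij <- [seq (i, j) | i <- enum 'I_d.+1, j <- enum 'I_d]].
  pose value (p : 'M[R]_(d.+1, d) * ('I_d.+1 * 'I_d)) (v : 'rV[R]_d -> 'rV[R]_d) :=
    v (row p.2.1 p.1) ord0 p.2.2.
  have value_lin p : linear_on (Vh Th Omega gam Gamma0 0) (value p).
    by move=> c v w _ _; rewrite /value !mxE.
  have value_eq0 v : Vh Th Omega gam Gamma0 0 v ->
      (forall p, p \in vertices -> value p v = 0) -> forall x, Omega x -> v x = 0.
    move=> [Xv _] v0; apply: (Xh_vertices_eq0 hTh Xv) => P i PTh.
    apply/rowP => j; rewrite mxE; apply: (v0 (P, (i, j))).
    apply/allpairsP; exists (P, (i, j)); split=> //=.
    by apply/allpairsP; exists (i, j); rewrite !mem_enum.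
  pose W := Vh Th Omega gam Gamma0 0; pose A := Vh Th Omega gam Gamma0 gh.
  have sW : linear_subspace W.
    exact: (Vh_subspace openO bndO hgam Th Gamma0_sub).
  have WH1 : W `<=` H1 Omega by move=> v; exact: Vh_H1.
  have AH1 : A `<=` H1 Omega by move=> v; exact: Vh_H1.
  have A_sub v w : A v -> A w -> W (v - w).
    exact: (Vh_sub openO bndO hgam Gamma0_sub).
  have A_add c z v : W z -> A v -> A (c *: z + v).
    exact: (Vh_add openO bndO hgam Gamma0_sub c).
  have dE := reduced_energy_derive alpha openO bndO hC ell_lin sW WH1 AH1 A_sub
    A_add value_lin value_eq0 Vu hphi hpsi equil.
  split; first by case: dE.
  rewrite /gateaux derive1E; case: dE => _ ->.
  rewrite (evolution_weak openO hu hphi hphi' evol hpsi).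
  by rewrite opprB.
- have equil' : ipC Omega lam mu (symgrad Omega (u k) - phi k)
      (symgrad Omega (u k.-1 - u k)) = ell k (u k.-1 - u k).
    by apply: equil; exact: (Vh_sub openO bndO hgam Gamma0_sub Vu' Vu).
  have step := energy_step openO bndO hC htau ell_lin hu hu' hphi hphi' evol equil'.
  split.
  + have EE : E k.-1 (u k.-1) (phi k.-1) =
        energy Omega lam mu alpha (ell k) (u k.-1) (phi k.-1).
      by rewrite /E /energy ellE.
    by rewrite norm2_sqr (normC_sqr Omega hC) -[RHS]step -EE.
  + by rewrite mulNr oppr_le0 mulr_ge0 ?sqr_ge0// ltW.
Qed.
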